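(* Let $k\in\{\mathbb{R},\mathbb{C}\}$. Each of the following categories over $k$, furnished with bounded linear maps as morphisms, is quasi-abelian but neither left integral nor right integral: (i) the category $\overset{\frown}{\mathcal{B}}c$ of separated bornological vector spaces; (ii) the category $\widehat{\mathcal{B}}c$ of complete bornological vector spaces. (Here $\overset{\frown}{\mathcal{B}}c$ and $\widehat{\mathcal{B}}c$ are just names for these two categories.)
   Context: A bornological vector space is a pair $(X,\mathcal{B}_X)$ where $X$ is a $k$-vector space and $\mathcal{B}_X$ is a convex bornology on $X$, i.e. a family of subsets of $X$ containing all singletons and closed under taking subsets, finite unions, multiplication by scalars $\lambda>0$, and absolutely convex hulls. A linear map $f\colon X\to Y$ is bounded if $f(B)\in\mathcal{B}_Y$ whenever $B\in\mathcal{B}_X$. For an absolutely convex $B\in\mathcal{B}_X$ let $X_B=\operatorname{span}B$ with the semi-norm $\|x\|_B=\inf\{\lambda>0 : x\in\lambda B\}$. The space $(X,\mathcal{B}_X)$ is separated if $\|\cdot\|_B$ is a norm for every absolutely convex $B\in\mathcal{B}_X$ (equivalently, $\{0\}$ is the only bounded linear subspace), and complete if every bounded set is contained in an absolutely convex $B\in\mathcal{B}_X$ for which $X_B$ is a Banach space. An additive category is pre-abelian if every morphism has a kernel and a cokernel. A morphism is called ''a kernel'' (resp. ''a cokernel'') if it is the kernel (resp. cokernel) of some morphism. A class $\mathcal{X}$ of morphisms is stable under pullback if in any pullback square with $a\colon A\to B$, $b\colon A\to C$, $c\colon B\to D$, $d\colon C\to D$ and $c\circ a=d\circ b$, one has $a\in\mathcal{X}$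 whenever $d\in\mathcal{X}$; stability under pushout is defined dually. A pre-abelian category is quasi-abelian if cokernels are stable under pullback and kernels are stable under pushout. A pre-abelian category is left integral if epimorphisms are stable under pullback, and right integral if monomorphisms are stable under pushout. *)

(* Defs.v *)
From HB Require Import structures.
From mathcomp Require Import all_boot all_order all_algebra.
From mathcomp Require Import complex.
From mathcomp Require Import all_classical all_reals all_analysis.

Set Implicit Arguments.
Unset Strict Implicit.
Unset Printing Implicit Defensive.

Import Order.TTheory GRing.Theory Num.Theory.
Import numFieldNormedType.Exports.

Local Open Scope classical_set_scope.
Local Open Scope ring_scope.

(** * Preadditive categories *)

Record preadditive := Preadditive {
  obj :> Type;
  hom : obj -> obj -> zmodType;
  idm : forall A, hom A A;
  comp : forall A B C, hom B C -> hom A B -> hom A C;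
  compA : forall A B C D (h : hom C D) (g : hom B C) (f : hom A B),
    comp h (comp g f) = comp (comp h g) f;
  comp1m : forall A B (f : hom A B), comp (idm B) f = f;
  compm1 : forall A B (f : hom A B), comp f (idm A) = f;
  compDl : forall A B C (g1 g2 : hom B C) (f : hom A B),
    comp (g1 + g2) f = comp g1 f + comp g2 f;
  compDr : forall A B C (g : hom B C) (f1 f2 : hom A B),
    comp g (f1 + f2) = comp g f1 + comp g f2 }.

Arguments hom {p} A B.
Arguments idm {p} A.

Notation "g \oc f" := (comp g f) (at level 40, left associativity).

Definition full_subcategory (C : preadditive) (P : C -> Prop) : preadditive :=
  @Preadditive {A : C | P A} (fun A B => hom (sval A) (sval B))
    (fun A => idm (sval A)) (fun A B D g f => g \oc f)
    (fun _ _ _ _ => @compA C _ _ _ _) (fun _ _ => @comp1m C _ _)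
    (fun _ _ => @compm1 C _ _) (fun _ _ _ => @compDl C _ _ _)
    (fun _ _ _ => @compDr C _ _ _).

Section CategoryNotions.
Variable C : preadditive.
Implicit Types A B D Z : C.

Definition monomorphism A B (f : hom A B) : Prop :=
  forall Z (g h : hom Z A), f \oc g = f \oc h -> g = h.

Definition epimorphism A B (f : hom A B) : Prop :=
  forall Z (g h : hom B Z), g \oc f = h \oc f -> g = h.

Definition zero_object Z : Prop :=
  forall A, (forall f : hom A Z, f = 0) /\ (forall f : hom Z A, f = 0).

Definition biproduct A B S (i1 : hom A S) (i2 : hom B S)
    (p1 : hom S A) (p2 : hom S B) : Prop :=
  [/\ p1 \oc i1 = idm A, p2 \oc i2 = idm B, p1 \oc i2 = 0, p2 \oc i1 = 0
    & i1 \oc p1 + i2 \oc p2 = idm S].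

Definition additive_category : Prop :=
  (exists Z, zero_object Z) /\
  forall A B, exists S (i1 : hom A S) (i2 : hom B S) (p1 : hom S A)
    (p2 : hom S B), biproduct i1 i2 p1 p2.

Definition kernel_of A B (f : hom A B) K (k : hom K A) : Prop :=
  f \oc k = 0 /\
  forall Z (g : hom Z A), f \oc g = 0 -> exists! u : hom Z K, k \oc u = g.

Definition cokernel_of A B (f : hom A B) Q (q : hom B Q) : Prop :=
  q \oc f = 0 /\
  forall Z (g : hom B Z), g \oc f = 0 -> exists! u : hom Q Z, u \oc q = g.

Definition is_kernel K A (k : hom K A) : Prop :=
  exists B (f : hom A B), kernel_of f k.

Definition is_cokernel B Q (q : hom B Q) : Prop :=
  exists A (f : hom A B), cokernel_of f q.

(* The square
       A --a--> B
       |        |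
       b        c
       v        v
       E --d--> D   *)
Definition pullback A B E D
    (a : hom A B) (b : hom A E) (c : hom B D) (d : hom E D) : Prop :=
  c \oc a = d \oc b /\
  forall Z (x : hom Z B) (y : hom Z E), c \oc x = d \oc y ->
    exists! u : hom Z A, a \oc u = x /\ b \oc u = y.

Definition pushout A B E D
    (a : hom A B) (b : hom A E) (c : hom B D) (d : hom E D) : Prop :=
  c \oc a = d \oc b /\
  forall Z (x : hom B Z) (y : hom E Z), x \oc a = y \oc b ->
    exists! u : hom D Z, u \oc c = x /\ u \oc d = y.

Definition stable_under_pullback (X : forall A B, hom A B -> Prop) : Prop :=
  forall A B E D (a : hom A B) (b : hom A E) (c : hom B D) (d : hom E D),
    pullback a b c d -> X _ _ d -> X _ _ a.

Definition stable_under_pushout (X : forall A B, hom A B -> Prop) : Prop :=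
  forall A B E D (a : hom A B) (b : hom A E) (c : hom B D) (d : hom E D),
    pushout a b c d -> X _ _ a -> X _ _ d.

Definition pre_abelian : Prop :=
  [/\ additive_category,
      forall A B (f : hom A B), exists K (k : hom K A), kernel_of f k
    & forall A B (f : hom A B), exists Q (q : hom B Q), cokernel_of f q].

Definition quasi_abelian : Prop :=
  [/\ pre_abelian, stable_under_pullback is_cokernel
    & stable_under_pushout is_kernel].

Definition left_integral : Prop :=
  pre_abelian /\ stable_under_pullback epimorphism.

Definition right_integral : Prop :=
  pre_abelian /\ stable_under_pushout monomorphism.

End CategoryNotions.

(** * Bornological vector spaces *)

Section Sets.
Variables (K : numFieldType) (X : lmodType K).

Definition absolutely_convex (B : set X) : Prop :=
  forall (a b : K) x y, `|a| + `|b| <= 1 -> B x -> B y -> B (a *: x + b *: y).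

Definition absolutely_convex_hull (B : set X) : set X :=
  smallest absolutely_convex B.

Definition linear_subspace (V : set X) : Prop :=
  V 0 /\ forall (a : K) x y, V x -> V y -> V (a *: x + y).

Definition linear_span (B : set X) : set X := smallest linear_subspace B.

End Sets.

Record bornSpace (K : numFieldType) := BornSpace {
  born_sort :> lmodType K;
  bornology : set (set born_sort);
  born1 : forall x, bornology [set x];
  born_sub : forall A B, A `<=` B -> bornology B -> bornology A;
  bornU : forall A B, bornology A -> bornology B -> bornology (A `|` B);
  (* [0 < l] in a numFieldType forces [l] to be real. *)
  bornZ : forall (l : K) B, 0 < l -> bornology B ->
    bornology [set l *: x | x in B];
  born_hull : forall B, bornology B -> bornology (absolutely_convex_hull B) }.

Section BoundedLinearMaps.
Variables (K : numFieldType) (X Y : bornSpace K).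

Definition bounded_linear : {pred (X -> Y)} := fun f =>
  `[< linear f /\ forall B, bornology B -> bornology (f @` B) >].

Record blmap := BLMap {
  blmap_fun :> X -> Y;
  blmapP : blmap_fun \in bounded_linear }.

HB.instance Definition _ := [isSub for blmap_fun].
HB.instance Definition _ := [Choice of blmap by <:].

Lemma bounded_linear_zmod_closed : zmod_closed bounded_linear.
Proof.
have bD (A B : set Y) : bornology A -> bornology B ->
    bornology [set a + b | a in A & b in B].
  move=> bA bB; have b2 : (0 : K) < 2 by rewrite ltr0n.
  apply: born_sub (bornZ b2 (born_hull (bornU bA bB))) => _ [a Aa [b Bb <-]].
  exists (2^-1 *: a + 2^-1 *: b); last first.
    by rewrite -scalerDr scalerA divff ?scale1r// pnatr_eq0.
  move=> M [acM sM]; apply: acM; [|by apply: sM; left|by apply: sM; right].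
  rewrite ger0_norm ?invr_ge0 ?ler0n//.
  by rewrite -(mulr2n 2^-1) -[2^-1 *+ 2]mulr_natl divff ?pnatr_eq0.
split; first apply/asboolP; first split.
- by move=> a x y; rewrite /= scaler0 addr0.
- by move=> B _; apply: born_sub (born1 (0 : Y)) => _ [x _ <-].
move=> f g /asboolP[lf bf] /asboolP[lg bg]; apply/asboolP; split.
- move=> a x y; change (f (a *: x + y) - g (a *: x + y)
    = a *: (f x - g x) + (f y - g y)).
  by rewrite lf lg scalerBr opprD !addrA; congr (_ + _); rewrite addrAC.
- move=> B bB.
  have bNB : bornology [set - y | y in g @` B].
    apply: born_sub (born_hull (bg _ bB)) => _ [y yB <-] M [acM sM].
    rewrite -[- y]addr0 -scaleN1r -(scale0r y); apply: acM; try exact: sM.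
    by rewrite normrN1 normr0 addr0.
  apply: born_sub (bD _ _ (bf _ bB) bNB) => _ [x Bx <-].
  exists (f x); first by exists x.
  by exists (- g x) => //; exists (g x) => //; exists x.
Qed.

HB.instance Definition _ := GRing.isZmodClosed.Build _ bounded_linear
  bounded_linear_zmod_closed.
HB.instance Definition _ := [SubChoice_isSubZmodule of blmap by <:].

End BoundedLinearMaps.

Section BornologicalCategory.
Variable K : numFieldType.
Implicit Types X Y Z T : bornSpace K.

Lemma bounded_linear_id X : (fun x : X => x) \in @bounded_linear K X X.
Proof.
by apply/asboolP; split=> [a x y //|B]; rewrite (_ : _ @` B = B)// image_id.
Qed.

Lemma bounded_linear_comp X Y Z (g : blmap Y Z) (f : blmap X Y) :
  (fun x => g (f x)) \in @bounded_linear K X Z.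
Proof.
have /asboolP[lf bf] := blmapP f; have /asboolP[lg bg] := blmapP g.
apply/asboolP; split=> [a x y|B bB] /=; first by rewrite lf lg.
by rewrite -(image_comp f g); apply/bg/bf.
Qed.

Definition blmap_id X : blmap X X := BLMap (bounded_linear_id X).

Definition blmap_comp X Y Z (g : blmap Y Z) (f : blmap X Y) : blmap X Z :=
  BLMap (bounded_linear_comp g f).

Lemma blmap_compA X Y Z T (h : blmap Z T) (g : blmap Y Z) (f : blmap X Y) :
  blmap_comp h (blmap_comp g f) = blmap_comp (blmap_comp h g) f.
Proof. exact: val_inj. Qed.

Lemma blmap_comp1m X Y (f : blmap X Y) : blmap_comp (blmap_id Y) f = f.
Proof. exact: val_inj. Qed.

Lemma blmap_compm1 X Y (f : blmap X Y) : blmap_comp f (blmap_id X) = f.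
Proof. exact: val_inj. Qed.

Lemma blmap_compDl X Y Z (g1 g2 : blmap Y Z) (f : blmap X Y) :
  blmap_comp (g1 + g2) f = blmap_comp g1 f + blmap_comp g2 f.
Proof. exact: val_inj. Qed.

Lemma blmap_compDr X Y Z (g : blmap Y Z) (f1 f2 : blmap X Y) :
  blmap_comp g (f1 + f2) = blmap_comp g f1 + blmap_comp g f2.
Proof.
apply: val_inj; apply/funext => x /=.
have /asboolP[lg _] := blmapP g.
by have := lg 1 (f1 x) (f2 x); rewrite !scale1r.
Qed.

Definition Born : preadditive :=
  Preadditive blmap_compA blmap_comp1m blmap_compm1 blmap_compDl blmap_compDr.

End BornologicalCategory.

(** * Separated and complete spaces *)

(* The scalar field [K] comes with the inclusion [iota] of the real numbers, so
   that semi-norms can be real-valued also when [K] is the complex field. *)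
Section SeparatedComplete.
Variables (R : realType) (K : numFieldType) (iota : R -> K).

(* Only meaningful for x in [linear_span B], where the set is nonempty (except
   for B = set0, where [inf set0 = 0] gives the zero norm on the zero space). *)
Definition disk_seminorm (X : lmodType K) (B : set X) (x : X) : R :=
  inf [set l : R | 0 < l /\ [set iota l *: y | y in B] x].

Definition disk_normed (X : lmodType K) (B : set X) : Prop :=
  forall x, linear_span B x -> disk_seminorm B x = 0 -> x = 0.

Definition disk_banach (X : lmodType K) (B : set X) : Prop :=
  disk_normed B /\
  forall u : nat -> X, (forall n, linear_span B (u n)) ->
    (forall e : R, 0 < e -> exists N, forall m n, (N <= m)%N -> (N <= n)%N ->
       disk_seminorm B (u m - u n) < e) ->
    exists2 l, linear_span B l & disk_seminorm B (u n - l) @[n --> \oo] --> 0.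

Definition separated (X : bornSpace K) : Prop :=
  forall B : set X, bornology B -> absolutely_convex B -> disk_normed B.

Definition bornologically_complete (X : bornSpace K) : Prop :=
  forall A : set X, bornology A -> exists B : set X,
    [/\ bornology B, absolutely_convex B, A `<=` B & disk_banach B].

Definition SepBorn : preadditive :=
  full_subcategory (C := Born K) separated.

Definition CplBorn : preadditive :=
  full_subcategory (C := Born K) bornologically_complete.

End SeparatedComplete.

(** * The scalar fields *)

Variant scalars := RealScalars | ComplexScalars.

Definition scalar_field (R : realType) (k : scalars) : numFieldType :=
  match k with RealScalars => R | ComplexScalars => R[i]%C end.

Definition scalar_incl (R : realType) (k : scalars) : R -> scalar_field R k :=
  match k with
  | RealScalars => id
  | ComplexScalars => real_complex R
  end.

(* Main.v *)
(** A space is separated iff no line is bounded, and a disk B is Banach iff every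
    series sum 2^-k d_k with d_k in B converges at the rate prescribed by B; both
    reformulations pass to bornologically closed subspaces, to quotients by these
    and to products.

    A morphism is a cokernel iff bounded sets lift along it, and a kernel iff it
    is injective, reflects bounded sets and has bornologically closed range. Both
    properties can be chased through concrete pullbacks and pushouts, so the
    categories are quasi-abelian.

    For the failure of integrality let D be the space of all scalar sequences, E
    the finitely supported ones with the fine bornology, and L the line of
    constant sequences. Then d : E -> D is an epimorphism, since E is dense, and
    meets c : L -> D trivially. Hence the pullback of d along c is 0 -> L, which
    is not an epimorphism, and the pushout of the monomorphism (c, d) : L + E ->
    D along the projection L + E -> L is L -> 0, which is not a monomorphism. *)

Require Import Defs.
From HB Require Import structures.
From mathcomp Require Import all_boot all_order all_algebra.
From mathcomp Require Import complex.
From mathcomp Require Import all_classical all_reals all_analysis.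
From mathcomp Require Import ring lra.
From mathcomp Require Import generic_quotient ring_quotient.

Set Implicit Arguments.
Unset Strict Implicit.
Unset Printing Implicit Defensive.

Import Order.TTheory GRing.Theory Num.Theory.
Import numFieldNormedType.Exports.
(* MathComp's vector.v also defines a hom. *)
Import Defs.

Local Open Scope classical_set_scope.
Local Open Scope ring_scope.
Local Open Scope quotient_scope.

(** * Linear subspaces and quotients *)

Section LinearFunctions.
Variables (K : numFieldType) (X Y : lmodType K) (f : X -> Y).
Hypothesis lf : linear f.

Lemma linearfD x y : f (x + y) = f x + f y.
Proof. by rewrite -[x]scale1r lf !scale1r. Qed.

Lemma linearf0 : f 0 = 0.
Proof. by apply: (addrI (f 0)); rewrite -linearfD !addr0. Qed.

Lemma linearfZ a x : f (a *: x) = a *: f x.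
Proof. by rewrite -[a *: x]addr0 lf linearf0 addr0. Qed.

Lemma linearfB x y : f (x - y) = f x - f y.
Proof. by rewrite linearfD -scaleN1r linearfZ scaleN1r. Qed.

Lemma linearf_sum (I : Type) (r : seq I) (P : pred I) (F : I -> X) :
  f (\sum_(i <- r | P i) F i) = \sum_(i <- r | P i) f (F i).
Proof. exact: (big_morph f linearfD linearf0). Qed.

Lemma absolutely_convex_image B :
  absolutely_convex B -> absolutely_convex (f @` B).
Proof.
move=> acB a b _ _ ab [x Bx <-] [y By <-].
by exists (a *: x + b *: y); [exact: acB|rewrite linearfD !linearfZ].
Qed.

Lemma absolutely_convex_preimage B :
  absolutely_convex B -> absolutely_convex (f @^-1` B).
Proof.
move=> acB a b x y ab Bx By; rewrite /preimage/= linearfD !linearfZ.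
exact: acB.
Qed.

Lemma linear_subspace_range : linear_subspace (range f).
Proof.
split; first by exists 0 => //; exact: linearf0.
by move=> a _ _ [x _ <-] [y _ <-]; exists (a *: x + y) => //; exact: lf.
Qed.

Lemma linear_subspace_kernel : linear_subspace [set x | f x = 0].
Proof.
split=> /=; first exact: linearf0.
by move=> a x y fx fy; rewrite lf fx fy scaler0 addr0.
Qed.

End LinearFunctions.

Section Subspaces.
Variables (K : numFieldType) (X : lmodType K) (V : set X).
Hypothesis sV : linear_subspace V.

Lemma linear_subspaceZ a x : V x -> V (a *: x).
Proof. by case: sV => V0 Vl Vx; rewrite -[_ *: _]addr0; exact: Vl. Qed.

Lemma linear_subspaceD x y : V x -> V y -> V (x + y).
Proof. by case: sV => V0 Vl Vx Vy; rewrite -[x]scale1r; exact: Vl. Qed.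

Lemma linear_subspaceB x y : V x -> V y -> V (x - y).
Proof.
by move=> Vx Vy; rewrite -scaleN1r; apply/linear_subspaceD/linear_subspaceZ.
Qed.

Lemma linear_subspace_sum (I : Type) (r : seq I) (P : pred I) (F : I -> X) :
  (forall i, V (F i)) -> V (\sum_(i <- r | P i) F i).
Proof.
move=> VF; elim/big_ind : _ => //; first by case: sV.
exact: linear_subspaceD.
Qed.

Let Vpred : {pred X} := fun x => `[< V x >].

Let Vpred_submod : submod_closed Vpred.
Proof.
split=> [|a x y]; first by apply/asboolP; case: sV.
by move=> /asboolP Vx /asboolP Vy; apply/asboolP; case: sV => _; exact.
Qed.

HB.instance Definition _ := GRing.isSubmodClosed.Build K X Vpred Vpred_submod.

Record subspace_type := SubspaceType {
  subspace_val :> X; subspace_valP : subspace_val \in Vpred }.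

HB.instance Definition _ := [isSub for subspace_val].
HB.instance Definition _ := [Choice of subspace_type by <:].
HB.instance Definition _ :=
  [SubChoice_isSubLmodule of subspace_type by <:].

(** A bornological space is carried by a module type, so a subspace is replaced by a module type
    with a linear injection onto it; later arguments use only these three properties. *)
Lemma subspace_model : exists (S : lmodType K) (i : S -> X),
  [/\ linear i, injective i & range i = V].
Proof.
exists subspace_type, subspace_val; split => //; first exact: val_inj.
apply/seteqP; split=> [_ [s _ <-]|x Vx].
  by have /asboolP := subspace_valP s.
have Vx' : x \in Vpred by apply/asboolP.
by exists (SubspaceType Vx').
Qed.

Let Q := Quotient.quot Vpred.

(** [Q] is a quotient of additive groups; scalars act through representatives, and [piZ] shows that
    the choice does not matter. *)
Let scaleq (a : K) (x : Q) : Q := \pi_Q (a *: repr x).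

Let pi_eq (x y : X) : \pi_Q x = \pi_Q y <-> V (x - y).
Proof.
split=> [/eqP|Vxy]; first by rewrite -Quotient.idealrBE => /asboolP.
by apply/eqP; rewrite -Quotient.idealrBE; apply/asboolP.
Qed.

Let piZ a x : \pi_Q (a *: x) = scaleq a (\pi_Q x).
Proof.
apply/pi_eq; rewrite -scalerBr; apply: linear_subspaceZ; apply/pi_eq.
by rewrite reprK.
Qed.

Let piD x y : \pi_Q (x + y) = \pi_Q x + \pi_Q y.
Proof. by rewrite !piE. Qed.

Let scaleqA a b (x : Q) : scaleq a (scaleq b x) = scaleq (a * b) x.
Proof. by rewrite -(piZ a (b *: repr x)) scalerA. Qed.

Let scaleq1 : left_id 1 scaleq.
Proof. by move=> x; rewrite /scaleq scale1r reprK. Qed.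

Let scaleqDr : right_distributive scaleq +%R.
Proof.
move=> a x y; rewrite -{1}[x]reprK -{1}[y]reprK -piD -piZ.
by rewrite scalerDr piD.
Qed.

Let scaleqDl (x : Q) : {morph scaleq^~ x : a b / a + b}.
Proof. by move=> a b; rewrite /scaleq scalerDl piD. Qed.

Definition quotient_type : Type := Q.

HB.instance Definition _ := GRing.Zmodule.on quotient_type.
HB.instance Definition _ := GRing.Zmodule_isLmodule.Build K quotient_type
  scaleqA scaleq1 scaleqDr scaleqDl.

Lemma quotient_model : exists (S : lmodType K) (q : X -> S),
  [/\ linear q, forall y, exists x, q x = y & [set x | q x = 0] = V].
Proof.
have lpi : linear (fun x => \pi_Q x : quotient_type).
  by move=> a x y; rewrite piD piZ.
exists quotient_type, (fun x => \pi_Q x); split => //.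
- by move=> y; exists (repr (y : Q)); rewrite reprK.
apply/seteqP; split=> x /=; rewrite -(linearf0 lpi).
- by move/pi_eq; rewrite subr0.
- by move=> Vx; apply/pi_eq; rewrite subr0.
Qed.

End Subspaces.

(** * Bornologies on subspaces, quotients and products *)

Section AbsolutelyConvexHull.
Variables (K : numFieldType) (X : lmodType K).
Implicit Types B : set X.

Lemma absolutely_convex_hullP B : absolutely_convex (absolutely_convex_hull B).
Proof.
by move=> a b x y ab Bx By M MP; apply: MP.1 => //; [exact: Bx|exact: By].
Qed.

Lemma sub_absolutely_convex_hull B : B `<=` absolutely_convex_hull B.
Proof. by move=> x Bx M MP; exact: MP.2. Qed.

Lemma absolutely_convex_hull_min B M :
  absolutely_convex M -> B `<=` M -> absolutely_convex_hull B `<=` M.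
Proof. by move=> acM BM x; apply. Qed.

Lemma absolutely_convexZ B a x :
  absolutely_convex B -> `|a| <= 1 -> B x -> B (a *: x).
Proof.
move=> acB a1 Bx; rewrite -[a *: x]addr0 -[X in _ + X](scale0r x).
by apply: acB => //; rewrite normr0 addr0.
Qed.

End AbsolutelyConvexHull.

Section Bornologies.
Variables (K : numFieldType) (X : bornSpace K).
Implicit Types A B V : set X.

Lemma born_balanced c B : 0 < c -> bornology B ->
  bornology [set a *: x | a in [set a | `|a| <= c] & x in B].
Proof.
move=> c0 bB; apply: born_sub (bornZ c0 (born_hull bB)) => _ [a ac [x Bx <-]].
exists ((c^-1 * a) *: x); last by rewrite scalerA mulVKf// gt_eqF.
apply: (absolutely_convexZ (B := absolutely_convex_hull B)).
  exact: absolutely_convex_hullP.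
  by rewrite normrM gtr0_norm ?invr_gt0// ler_pdivrMl// mulr1.
exact: sub_absolutely_convex_hull.
Qed.

Lemma bornN B : bornology B -> bornology [set - x | x in B].
Proof.
move=> bB; apply: born_sub (born_balanced ltr01 bB) => _ [x Bx <-].
by exists (-1) => /=; [rewrite normrN1|exists x => //; rewrite scaleN1r].
Qed.

(** A sum is twice a midpoint, and midpoints lie in the absolutely convex hull of the union. *)
Lemma bornD A B :
  bornology A -> bornology B -> bornology [set a + b | a in A & b in B].
Proof.
move=> bA bB; apply: born_sub (bornZ (ltr0n K 2) (born_hull (bornU bA bB))).
move=> _ [a Aa [b Bb <-]]; exists (2^-1 *: a + 2^-1 *: b); last first.
  by rewrite -scalerDr scalerA divff ?scale1r// pnatr_eq0.
apply: (@absolutely_convex_hullP _ _ (A `|` B)).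
- rewrite ger0_norm ?invr_ge0// -(mulr2n 2^-1) -[2^-1 *+ 2]mulr_natl.
  by rewrite divff ?pnatr_eq0.
- by apply: sub_absolutely_convex_hull; left.
- by apply: sub_absolutely_convex_hull; right.
Qed.

(** For a linear subspace V, the premise says that the image of x in X/V spans a bounded line for
    the quotient bornology. So V is closed exactly when X/V is separated. *)
Definition born_closed V := forall B x, bornology B ->
  (forall a : K, exists2 b, B b & V (a *: x - b)) -> V x.

Lemma born_closed_bigcap (F : set (set X)) :
  (forall V, F V -> born_closed V) -> born_closed (\bigcap_(V in F) V).
Proof.
move=> Fcl B x bB Bx V FV; apply: (Fcl _ FV _ _ bB) => a.
by have [b Bb ab] := Bx a; exists b => //; exact: ab.
Qed.

Definition line_separated :=
  forall x : X, bornology (range (fun a : K => a *: x)) -> x = 0.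

Lemma line_separatedP B (x : X) : line_separated -> bornology B ->
  (forall a : K, B (a *: x)) -> x = 0.
Proof. by move=> sX bB Bx; apply: sX; apply: born_sub bB => _ [a _ <-]. Qed.

End Bornologies.

Section BoundedLinear.
Variables (K : numFieldType) (X Y : bornSpace K) (f : blmap X Y).

Lemma blmap_linear : linear f.
Proof. by have /asboolP[] := blmapP f. Qed.

Lemma blmap_bounded B : bornology B -> bornology (f @` B).
Proof. by have /asboolP[_] := blmapP f; exact. Qed.

(** If [a *: x - b] is in the kernel, then a f(x) = f(b), so the line through f(x) lies in the
    bounded set f(B). *)
Lemma born_closed_kernel : line_separated Y -> born_closed [set x | f x = 0].
Proof.
move=> sY B x bB Bx; apply: (line_separatedP sY (blmap_bounded bB)) => a.
have [b Bb /=] := Bx a; rewrite (linearfB blmap_linear) => /subr0_eq fab.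
by exists b => //; rewrite -(linearfZ blmap_linear).
Qed.

End BoundedLinear.

(* A reformulation of "the gauge space of B is Banach" that avoids gauges; the
   constant 4 rather than 2 leaves room for disks that are not closed. *)
Definition series_complete (K : numFieldType) (X : lmodType K) (B : set X) :=
  forall d : nat -> X, (forall k, B (d k)) -> exists s, forall N,
    exists2 b, B b & s - \sum_(k < N) 2^-1 ^+ k *: d k = (4 * 2^-1 ^+ N) *: b.

Definition series_complete_space (K : numFieldType) (X : bornSpace K) :=
  forall A : set X, bornology A -> exists B : set X,
    [/\ bornology B, absolutely_convex B, A `<=` B, B 0 & series_complete B].

Section InducedBornology.
Variables (K : numFieldType) (X : bornSpace K) (S : lmodType K) (i : S -> X).
Hypothesis li : linear i.

Definition induced_born : bornSpace K.
Proof.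
refine (@BornSpace K S [set A | bornology (i @` A)] _ _ _ _ _) => /=.
- by move=> x; rewrite image_set1; exact: born1.
- by move=> A B AB; apply: born_sub; exact: image_subset.
- by move=> A B bA bB; rewrite image_setU; exact: bornU.
- move=> l B l0 bB; apply: born_sub (bornZ l0 bB) => _ [_ [x Bx <-] <-].
  by exists (i x); [exists x|rewrite (linearfZ li)].
- move=> B bB; apply: born_sub (born_hull bB) => _ [x Bx <-].
  suff: absolutely_convex_hull B `<=` i @^-1` absolutely_convex_hull (i @` B).
    exact.
  apply: absolutely_convex_hull_min => [|y By].
    apply: (absolutely_convex_preimage li).
    exact: absolutely_convex_hullP.
  by apply: sub_absolutely_convex_hull; exists y.
Defined.

Hypothesis archiK : forall a : K, exists n, `|a| <= n%:R.
Hypothesis inj_i : injective i.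

Lemma line_separated_induced : line_separated X -> line_separated induced_born.
Proof.
move=> sX x bx; apply: inj_i; rewrite (linearf0 li).
apply: (line_separatedP sX bx) => a.
by exists (a *: x); [exists a|rewrite (linearfZ li)].
Qed.

(** The series is summed in X with a disk B found there; closedness of the range brings the sum back
    to S, where the preimage of B serves as disk. *)
Lemma series_complete_induced : born_closed (range i) ->
  series_complete_space X -> series_complete_space induced_born.
Proof.
move=> cl cX A bA; have [B [bB acB AB B0 sB]] := cX _ bA.
exists (i @^-1` B : set S); split.
- by apply: born_sub bB => _ [x Bx <-].
- exact: absolutely_convex_preimage.
- by move=> x Ax; apply: AB; exists x.
- by rewrite /preimage/= (linearf0 li).
move=> d Bd; have [s sP] := sB _ Bd.
suff [t _ ts] : range i s.
  exists t => N; have [b Bb sNb] := sP N.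
  have c0 : 4 * 2^-1 ^+ N != 0 :> K.
    by rewrite mulf_neq0 ?expf_neq0 ?invr_eq0 ?pnatr_eq0.
  set r := t - _; exists ((4 * 2^-1 ^+ N)^-1 *: r); last first.
    by rewrite scalerA divff ?scale1r.
  rewrite /preimage/= (linearfZ li) (linearfB li) (linearf_sum li) ts.
  under eq_bigr do rewrite (linearfZ li).
  by rewrite sNb scalerA mulVf// scale1r.
(* The n-th partial sum lies in the range and misses s by [4 * 2^-n] times some b in B; since |4a|
   <= n <= 2^n, the error multiplied by a is still in B. *)
apply: cl bB _ => a; have [n an] := archiK (a * 4).
have [b Bb sNb] := sP n; exists ((a * (4 * 2^-1 ^+ n)) *: b).
  apply: absolutely_convexZ => //; rewrite mulrA normrM normrX.
  rewrite [`|2^-1|]ger0_norm ?invr_ge0// exprVn ler_pdivrMr ?exprn_gt0// mul1r.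
  by apply: le_trans an _; rewrite -natrX ler_nat ltnW// ltn_expl.
rewrite -scalerA -sNb -scalerBr opprB addrC subrK.
exists (a *: \sum_(k < n) 2^-1 ^+ k *: d k) => //.
rewrite (linearfZ li) (linearf_sum li).
by under eq_bigr do rewrite (linearfZ li).
Qed.

End InducedBornology.

Section QuotientBornology.
Variables (K : numFieldType) (X : bornSpace K) (Q : lmodType K) (q : X -> Q).
Hypotheses (lq : linear q) (sq : forall y, exists x, q x = y).

Definition quotient_born : bornSpace K.
Proof.
refine (@BornSpace K Q
  [set A | exists2 B, bornology B & A `<=` q @` B] _ _ _ _ _) => /=.
- move=> y; have [x <-] := sq y; exists [set x]; first exact: born1.
  by rewrite image_set1.
- by move=> A B AB [C bC BC]; exists C => //; exact: subset_trans BC.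
- move=> A B [A' bA' AA'] [B' bB' BB']; exists (A' `|` B'); first exact: bornU.
  by rewrite image_setU; exact: setUSS.
- move=> l A l0 [B bB AB]; exists [set l *: x | x in B]; first exact: bornZ.
  move=> _ [y /AB[x Bx <-] <-].
  by exists (l *: x); [exists x|rewrite (linearfZ lq)].
- move=> A [B bB AB]; exists (absolutely_convex_hull B); first exact: born_hull.
  apply: absolutely_convex_hull_min.
    apply: (absolutely_convex_image lq).
    exact: absolutely_convex_hullP.
  apply: (subset_trans AB); apply: image_subset.
  exact: sub_absolutely_convex_hull.
Defined.

(** If a q(x) = q(b), then [a *: x - b] is in the kernel, so a bounded line through q(x) supplies
    the premise of closedness. *)
Lemma line_separated_quotient :
  born_closed [set x | q x = 0] -> line_separated quotient_born.
Proof.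
move=> cl y [B bB By]; have [x xy] := sq y; rewrite -xy; apply: cl bB _ => a.
have [|b Bb qb] := By (a *: y); first by exists a.
by exists b => //=; rewrite (linearfB lq) (linearfZ lq) qb xy subrr.
Qed.

(** The terms lift to the disk B of X; the sum and the remainders found there are pushed forward by
    q. *)
Lemma series_complete_quotient :
  series_complete_space X -> series_complete_space quotient_born.
Proof.
move=> cX A [A' /cX[B [bB acB A'B B0 sB]] AA']; exists (q @` B); split.
- by exists B.
- exact: absolutely_convex_image.
- by apply: (subset_trans AA'); exact: image_subset.
- by exists 0 => //; exact: linearf0.
move=> d Bd; have [e Be qe] := all_sig2 (fun k => cid2 (Bd k)).
have [s sP] := sB _ Be; exists (q s) => N; have [b Bb sNb] := sP N.
exists (q b); first by exists b.
rewrite -(linearfZ lq) -sNb (linearfB lq) (linearf_sum lq); congr (_ - _).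
by apply: eq_bigr => k _; rewrite (linearfZ lq) qe.
Qed.

End QuotientBornology.

Section ProductBornology.
Variables (K : numFieldType) (X Y : bornSpace K).

Definition product_born : bornSpace K.
Proof.
refine (@BornSpace K (X * Y)%type [set A | exists B C,
  [/\ bornology B, bornology C & A `<=` B `*` C]] _ _ _ _ _) => /=.
- move=> [x y]; exists [set x], [set y]; split; [exact: born1|exact: born1|].
  by move=> _ ->.
- move=> A B AB [C [D [bC bD BCD]]]; exists C, D; split => //.
  exact: subset_trans BCD.
- move=> A A' [B [C [bB bC AB]]] [B' [C' [bB' bC' AB']]].
  exists (B `|` B'), (C `|` C'); split; [exact: bornU|exact: bornU|].
  by move=> z [/AB[]|/AB'[]]; split; [left|left|right|right].
- move=> l A l0 [B [C [bB bC AB]]].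
  exists [set l *: x | x in B], [set l *: x | x in C].
  split; [exact: bornZ|exact: bornZ|].
  by move=> _ [z /AB[Bz Cz] <-]; split; [exists z.1|exists z.2].
- move=> A [B [C [bB bC AB]]].
  exists (absolutely_convex_hull B), (absolutely_convex_hull C).
  split; [exact: born_hull|exact: born_hull|].
  apply: absolutely_convex_hull_min.
    move=> a b z t ab [z1 z2] [t1 t2].
    by split; exact: absolutely_convex_hullP.
  by move=> z /AB[Bz Cz]; split; exact: sub_absolutely_convex_hull.
Defined.

Lemma line_separated_product :
  line_separated X -> line_separated Y -> line_separated product_born.
Proof.
move=> sX sY [x y] [B [C [bB bC BC]]].
have xyP a : (B `*` C) (a *: x, a *: y) by apply: BC; exists a.
congr pair; [apply: (line_separatedP sX bB)|apply: (line_separatedP sY bC)] => a.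
- by have [] := xyP a.
- by have [] := xyP a.
Qed.

Lemma series_complete_product : series_complete_space X ->
  series_complete_space Y -> series_complete_space product_born.
Proof.
move=> cX cY A [A1 [A2 [/cX[B [bB acB AB B0 sB]] /cY[C [bC acC AC C0 sC]] AA]]].
exists (B `*` C); split => //.
- by exists B, C; split.
- by move=> a b z t ab [z1 z2] [t1 t2]; split; [exact: acB|exact: acC].
- by move=> z /AA[/AB Bz /AC Cz].
move=> d Bd.
have [s sP] : exists s, forall N, exists2 b, B b &
    s - \sum_(k < N) 2^-1 ^+ k *: (d k).1 = (4 * 2^-1 ^+ N) *: b.
  by apply: (sB (fun k => (d k).1)) => k; have [] := Bd k.
have [t tP] : exists s, forall N, exists2 b, C b &
    s - \sum_(k < N) 2^-1 ^+ k *: (d k).2 = (4 * 2^-1 ^+ N) *: b.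
  by apply: (sC (fun k => (d k).2)) => k; have [] := Bd k.
exists (s, t) => N; have [b Bb sb] := sP N; have [c Cc tc] := tP N.
exists (b, c) => //; apply/pair_equal_spec; split => /=.
- by rewrite -sb; congr (_ - _); rewrite (linearf_sum (f := fst)).
- by rewrite -tc; congr (_ - _); rewrite (linearf_sum (f := snd)).
Qed.

End ProductBornology.

(** * Categorical part *)

Section Preadditive.
Variable C : preadditive.
Implicit Types A B D E L Z : C.

Lemma comp0m A B D (f : hom A B) : (0 : hom B D) \oc f = 0.
Proof. by apply: (addrI (0 \oc f)); rewrite -compDl !addr0. Qed.

Lemma compm0 A B D (f : hom B D) : f \oc (0 : hom A B) = 0.
Proof. by apply: (addrI (f \oc 0)); rewrite -compDr !addr0. Qed.

Lemma compNm A B D (g : hom B D) (f : hom A B) : (- g) \oc f = - (g \oc f).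
Proof. by apply/eqP; rewrite -addr_eq0 -compDl addNr comp0m. Qed.

Lemma compmN A B D (g : hom B D) (f : hom A B) : g \oc (- f) = - (g \oc f).
Proof. by apply/eqP; rewrite -addr_eq0 -compDr addNr compm0. Qed.

(** Here k = 0, so [idm Z] and 0 both factor k through itself, and uniqueness makes them equal. *)
Lemma zero_object_kernel A Z (k : hom Z A) :
  kernel_of (idm A) k -> zero_object Z.
Proof.
move=> [kid ku]; rewrite comp1m in kid.
have idZ : idm Z = 0.
  have [u [_ uP]] := ku _ k (etrans (comp1m k) kid).
  by rewrite -(uP (idm Z) (compm1 k)) (uP 0)// compm0 kid.
by move=> B; split=> f; [rewrite -(comp1m f)|rewrite -(compm1 f)];
  rewrite idZ ?comp0m ?compm0.
Qed.

Section DenseAndComplementary.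
Variables (L E D : C) (c : hom L D) (d : hom E D).
Hypothesis epi_d : epimorphism d.
Hypothesis disjoint_cd : forall Z (x : hom Z L) (y : hom Z E),
  c \oc x = d \oc y -> x = 0 /\ y = 0.
Hypothesis L_neq0 : idm L <> 0.

Lemma epi_disjoint_not_left_integral : ~ left_integral C.
Proof.
move=> [[[[Z Z0] _] _ _] stable].
(* By disjointness the only cone is zero, so the zero object is the pullback. *)
have pb : pullback (0 : hom Z L) (0 : hom Z E) c d.
  split=> [|T x y /disjoint_cd[-> ->]]; first by rewrite !compm0.
  exists 0; split=> [|u _]; first by rewrite !comp0m.
  by rewrite (proj1 (Z0 T) u).
apply: L_neq0; apply: (stable _ _ _ _ _ _ _ _ pb epi_d).
by rewrite !compm0.
Qed.

Lemma epi_disjoint_not_right_integral : ~ right_integral C.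
Proof.
move=> [[[[Z Z0] bip] _ _] stable].
have [S [i1 [i2 [p1 [p2 [p1i1 p2i2 p1i2 p2i1 ip]]]]]] := bip L E.
(* This is (c, d) on the biproduct. If it agrees on g and h, then c p1(g - h) = d p2(h - g), and
   disjointness kills both components. *)
pose m := c \oc p1 + d \oc p2.
have mono_m : monomorphism m.
  move=> T g h mgh.
  have /disjoint_cd[p1gh p2gh] :
      c \oc (p1 \oc (g - h)) = d \oc (p2 \oc (h - g)).
    apply/eqP; rewrite -(opprB g h) !compmN -subr_eq0 opprK !compA -compDl.
    by rewrite compDr compmN mgh subrr.
  apply/eqP; rewrite -subr_eq0 -[g - h]comp1m -ip compDl -!compA p1gh.
  by rewrite -(opprB h g) !compmN p2gh compm0 compm0 oppr0 addr0.
(* For a cocone (x, y), restriction to E gives x d = 0, hence x = 0 as d is an epimorphism;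
   restriction to L then gives y = x c = 0. *)
have po : pushout m p1 (0 : hom D Z) (0 : hom L Z).
  split=> [|T x y xy]; first by rewrite !comp0m.
  have x0 : x = 0.
    apply: epi_d; rewrite comp0m.
    transitivity (x \oc m \oc i2); last by rewrite xy -compA p1i2 compm0.
    by rewrite -compA compDl -!compA p1i2 p2i2 compm0 compm1 add0r.
  have y0 : y = 0 by rewrite -[y]compm1 -p1i1 compA -xy x0 !comp0m.
  exists 0; split=> [|u _]; first by rewrite x0 y0 !comp0m.
  by rewrite (proj2 (Z0 T) u).
apply: L_neq0; apply: (stable _ _ _ _ _ _ _ _ po mono_m).
by rewrite !comp0m.
Qed.

End DenseAndComplementary.
End Preadditive.

(* Common properties of the separated and of the complete spaces: all that the
   categorical arguments use. *)
Record admissible (K : numFieldType) (P : bornSpace K -> Prop) := Admissible {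
  admissible_separated : forall X, P X -> line_separated X;
  admissible_induced : forall (X : bornSpace K) (S : lmodType K) (i : S -> X)
    (li : linear i), injective i -> born_closed (range i) ->
    P X -> P (induced_born li);
  admissible_quotient : forall (X : bornSpace K) (Q : lmodType K) (q : X -> Q)
    (lq : linear q) (sq : forall y, exists x, q x = y),
    born_closed [set x | q x = 0] -> P X -> P (quotient_born lq sq);
  admissible_product : forall X Y, P X -> P Y -> P (product_born X Y) }.

Lemma admissible_line_separated (K : numFieldType) :
  admissible (@line_separated K).
Proof.
split=> //.
- by move=> X S i li inj_i _; exact: line_separated_induced.
- by move=> X Q q lq sq cl _; exact: line_separated_quotient.
- exact: line_separated_product.
Qed.

Lemma admissible_series_complete (K : numFieldType) :
  (forall a : K, exists n, `|a| <= n%:R) ->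
  admissible
    (fun X : bornSpace K => line_separated X /\ series_complete_space X).
Proof.
move=> archiK; split.
- by move=> X [].
- move=> X S i li inj_i cl [sX cX]; split; first exact: line_separated_induced.
  exact: series_complete_induced.
- move=> X Q q lq sq cl [sX cX]; split; first exact: line_separated_quotient.
  exact: series_complete_quotient.
- move=> X Y [sX cX] [sY cY]; split; first exact: line_separated_product.
  exact: series_complete_product.
Qed.

(** * Kernels, cokernels and quasi-abelianness for admissible classes of spaces *)

Section AdmissibleCategory.
Variables (K : numFieldType) (P : bornSpace K -> Prop).
Hypothesis admP : admissible P.
Local Notation C := (full_subcategory (C := Born K) P).
Implicit Types A B D E Q S Z : C.

Definition bspace A : bornSpace K := sval A.

Definition app A B (f : hom A B) : bspace A -> bspace B :=
  @blmap_fun K (sval A) (sval B) f.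

Lemma homP A B (f g : hom A B) : (forall x, app f x = app g x) -> f = g.
Proof. by move=> fg; apply: val_inj; apply/funext. Qed.

Lemma app_linear A B (f : hom A B) : linear (app f).
Proof. exact: (@blmap_linear K (sval A) (sval B)). Qed.

Lemma app_bounded A B (f : hom A B) U :
  bornology U -> bornology (app f @` U).
Proof. exact: (@blmap_bounded K (sval A) (sval B)). Qed.

Lemma hom_of A B (f : bspace A -> bspace B) : linear f ->
  (forall U, bornology U -> bornology (f @` U)) ->
  exists h : hom A B, app h = f.
Proof.
move=> lf bf.
have fP : f \in @bounded_linear K (sval A) (sval B) by apply/asboolP.
by exists (BLMap fP).
Qed.

Lemma app_comp A B D (g : hom B D) (f : hom A B) x :
  app (g \oc f) x = app g (app f x).
Proof. by []. Qed.

Lemma app_id A x : app (idm A) x = x.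
Proof. by []. Qed.

Lemma app_add A B (f g : hom A B) x : app (f + g) x = app f x + app g x.
Proof. by []. Qed.

Lemma app_opp A B (f : hom A B) x : app (- f) x = - app f x.
Proof. by []. Qed.

Lemma app_zero A B x : app (0 : hom A B) x = 0.
Proof. by []. Qed.

Lemma app_eq A B (f g : hom A B) x : f = g -> app f x = app g x.
Proof. by move->. Qed.

Definition app0 A B (f : hom A B) := linearf0 (app_linear f).
Definition appB A B (f : hom A B) := linearfB (app_linear f).
Definition appD A B (f : hom A B) := linearfD (app_linear f).
Definition appZ A B (f : hom A B) := linearfZ (app_linear f).

Lemma separated_space A : line_separated (bspace A).
Proof. exact: (admissible_separated admP (svalP A)). Qed.

Lemma born_closed_ker A B (f : hom A B) : born_closed [set x | app f x = 0].
Proof.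
by apply: (@born_closed_kernel K (sval A) (sval B)); exact: separated_space.
Qed.

Definition lifts_bounded A B (q : hom A B) := forall U, bornology U ->
  exists2 T, bornology T & U `<=` app q @` T.

Definition reflects_bounded A B (k : hom A B) := forall U,
  bornology (app k @` U) -> bornology U.

Lemma lifts_bounded_surj A B (q : hom A B) : lifts_bounded q ->
  forall y, exists x, app q x = y.
Proof.
by move=> lq y; have [T _ /(_ y erefl)[x _]] := lq _ (born1 y); exists x.
Qed.

(** For a set-theoretic section s of q, the factor is g s. As g vanishes on the kernel of q, g(s(q
    x)) = g(x); this makes g s linear, and lifting of bounded sets makes it bounded. *)
Lemma factor_through_lift A B Z (q : hom A B) (g : hom A Z) :
  lifts_bounded q -> (forall x, app q x = 0 -> app g x = 0) ->
  exists! u : hom B Z, u \oc q = g.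
Proof.
move=> lq qg; have [s sP] := choice (lifts_bounded_surj lq).
have gs x : app g (s (app q x)) = app g x.
  by apply: subr0_eq; rewrite -appB; apply: qg; rewrite appB sP subrr.
have [||u uE] := @hom_of B Z (fun y => app g (s y)).
- move=> a y z /=; rewrite -(app_linear g) -[RHS]gs (app_linear q) !sP.
  by [].
- move=> U /lq[T bT UT]; apply: born_sub (app_bounded g bT).
  by move=> _ [y /UT[x Tx <-] <-]; exists x => //; rewrite gs.
exists u; split; first by apply: homP => x; rewrite app_comp uE gs.
move=> v vq; apply: homP => y; rewrite -(sP y) -!app_comp vq app_comp uE.
by rewrite gs.
Qed.

(** The factor sends z to the unique preimage of g(z) under k; it is bounded because k reflects
    bounded sets. *)
Lemma factor_through_embedding A B Z (k : hom A B) (g : hom Z B) :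
  injective (app k) -> reflects_bounded k ->
  (forall z, range (app k) (app g z)) ->
  exists! u : hom Z A, k \oc u = g.
Proof.
move=> inj_k rk kg.
have /choice[s sP] : forall z, exists x, app k x = app g z.
  by move=> z; have [x _ xz] := kg z; exists x.
have [||u uE] := @hom_of Z A s.
- by move=> a y z; apply: inj_k; rewrite (app_linear k) !sP (app_linear g).
- move=> U bU; apply: rk; apply: born_sub (app_bounded g bU).
  by move=> _ [_ [z Uz <-] <-]; exists z => //; rewrite sP.
exists u; split; first by apply: homP => x; rewrite app_comp uE sP.
move=> v kv; apply: homP => z; apply: inj_k.
by rewrite -[RHS]app_comp kv uE sP.
Qed.

Lemma closed_subobject A (V : set (bspace A)) :
  linear_subspace V -> born_closed V -> exists S (i : hom S A),
  [/\ injective (app i), reflects_bounded i & range (app i) = V].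
Proof.
move=> sV cV; have [S [i [li inj_i iV]]] := subspace_model sV.
rewrite -iV in cV.
have PS := admissible_induced admP li inj_i cV (svalP A).
have [||h hE] := @hom_of (exist _ _ PS) A i => //.
by exists (exist _ _ PS), h; rewrite hE; split=> // U; rewrite hE.
Qed.

Lemma closed_quotient A (V : set (bspace A)) :
  linear_subspace V -> born_closed V -> exists Q (q : hom A Q),
  lifts_bounded q /\ [set x | app q x = 0] = V.
Proof.
move=> sV cV; have [Q [q [lq sq qV]]] := quotient_model sV.
rewrite -qV in cV.
have PQ := admissible_quotient admP lq sq cV (svalP A).
have [||h hE] := @hom_of A (exist _ _ PQ) q => //.
  by move=> U bU; exists U.
exists (exist _ _ PQ), h; rewrite hE; split=> // U [T bT UT].
by exists T => //; rewrite hE.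
Qed.

Lemma kernel_exists A B (f : hom A B) : exists S (k : hom S A),
  [/\ kernel_of f k, injective (app k), reflects_bounded k
    & range (app k) = [set x | app f x = 0]].
Proof.
have [S [k [inj_k rk kE]]] := closed_subobject
  (linear_subspace_kernel (app_linear f)) (born_closed_ker (f := f)).
exists S, k; split => //; split.
  apply: homP => x; rewrite app_comp app_zero.
  by have : range (app k) (app k x) by []; rewrite kE.
move=> Z g fg; apply: factor_through_embedding => // z.
by rewrite kE /= -app_comp fg.
Qed.

Lemma is_kernelP A B (k : hom A B) : is_kernel k <->
  [/\ injective (app k), reflects_bounded k & born_closed (range (app k))].
Proof.
split=> [[D [f [fk uk]]]|[inj_k rk cl]].
  (* The given kernel is compared with the concrete one: k0 u = k, k v = k0 and v u = id carry the
     three properties over. *)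
  have [S [k0 [[fk0 uk0] inj_k0 rk0 k0E]]] := kernel_exists f.
  have [u [k0u _]] := uk0 _ _ fk; have [v [kv _]] := uk _ _ fk0.
  have vu : v \oc u = idm A.
    have [w [_ wP]] := uk _ _ fk.
    by rewrite -(wP (v \oc u)) ?(wP (idm A)) ?compm1// compA kv.
  have vuE x : app v (app u x) = x by rewrite -app_comp vu.
  split.
  - move=> x y kxy; rewrite -(vuE x) -(vuE y); congr (app v _).
    by apply: inj_k0; rewrite -!app_comp k0u.
  - move=> U bU; have : bornology (app k0 @` (app u @` U)).
      apply: born_sub bU => _ [_ [x Ux <-] <-].
      by exists x => //; rewrite -app_comp k0u.
    move/rk0/(app_bounded v); apply: born_sub => x Ux.
    by exists (app u x) => //; exists x.
  - rewrite (_ : range _ = [set x | app f x = 0]); first exact: born_closed_ker.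
    rewrite -k0E; apply/seteqP; split=> _ [x _ <-].
      by exists (app u x) => //; rewrite -app_comp k0u.
    by exists (app v x) => //; rewrite -app_comp kv.
(* Conversely, k is the kernel of the quotient map by its closed range. *)
have [Q [q [_ qE]]] := closed_quotient (linear_subspace_range (app_linear k)) cl.
exists Q, q; split.
  apply: homP => x; rewrite app_comp app_zero.
  by have : range (app k) (app k x) by []; rewrite -qE.
move=> Z g qg; apply: factor_through_embedding => // z.
by rewrite -qE /= -app_comp qg.
Qed.

(** Divide by the smallest closed subspace containing the range of f: the kernel of any g with g f =
    0 is a closed subspace containing that range, so g factors. *)
Lemma cokernel_exists A B (f : hom A B) : exists Q (q : hom B Q),
  cokernel_of f q /\ lifts_bounded q.
Proof.
pose F := [set V : set (bspace B) |
  [/\ linear_subspace V, born_closed V & range (app f) `<=` V]].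
have [||Q [q [lq qE]]] := @closed_quotient B (\bigcap_(V in F) V).
- split=> [V [[]]//|a x y xF yF V FV]; have [[_ lV] _ _] := FV.
  by apply: lV; [exact: xF|exact: yF].
- by apply: born_closed_bigcap => V [].
exists Q, q; split=> //; split.
  apply: homP => x; rewrite app_comp app_zero.
  suff : [set y | app q y = 0] (app f x) by [].
  by rewrite qE => V [_ _]; apply; exists x.
move=> Z g gf; apply: factor_through_lift => // x qx.
have : [set y | app q y = 0] x by [].
rewrite qE => /(_ [set y | app g y = 0]); apply; split.
- exact: linear_subspace_kernel (app_linear g).
- exact: born_closed_ker.
- by move=> _ [y _ <-] /=; rewrite -app_comp gf.
Qed.

Lemma is_cokernelP A B (q : hom A B) : is_cokernel q <-> lifts_bounded q.
Proof.
split=> [[D [f [qf uq]]]|lq].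
  (* A bounded set is moved by u to the concrete cokernel and lifted there; v u = id shows that this
     is a lift along q. *)
  have [Q [q0 [[q0f uq0] lq0]]] := cokernel_exists f.
  have [u [uq0q _]] := uq _ _ q0f; have [v [vq _]] := uq0 _ _ qf.
  have vu : v \oc u = idm B.
    have [w [_ wP]] := uq _ _ qf.
    by rewrite -(wP (v \oc u)) ?(wP (idm B)) ?comp1m// -compA uq0q.
  move=> U /(app_bounded u)/lq0[T bT UT]; exists T => // y Uy.
  have [|x Tx q0x] := UT (app u y); first by exists y.
  by exists x => //; rewrite -vq app_comp q0x -app_comp vu.
(* Conversely, q is the cokernel of its kernel. *)
have [S [k [[qk _] _ _ kE]]] := kernel_exists q.
exists S, k; split=> // Z g gk; apply: factor_through_lift => // x qx.
have : [set x | app q x = 0] x by [].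
by rewrite -kE => -[y _ <-]; rewrite -app_comp gk.
Qed.

Lemma biproduct_exists A B : exists S (i1 : hom A S) (i2 : hom B S)
  (p1 : hom S A) (p2 : hom S B), biproduct i1 i2 p1 p2.
Proof.
pose S : C := exist _ _ (admissible_product admP (svalP A) (svalP B)).
have b0 E : bornology [set (0 : bspace E)] by exact: born1.
have [||i1 i1E] := @hom_of A S (fun x => (x, 0) : (bspace A * bspace B)%type).
- by move=> a x y; congr pair; rewrite /= scaler0 addr0.
- move=> U bU; exists U, [set 0]; split; [exact: bU|exact: b0|].
  by move=> _ [x Ux <-].
have [||i2 i2E] := @hom_of B S (fun x => (0, x) : (bspace A * bspace B)%type).
- by move=> a x y; congr pair; rewrite /= scaler0 addr0.
- move=> U bU; exists [set 0], U; split; [exact: b0|exact: bU|].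
  by move=> _ [x Ux <-].
have [||p1 p1E] := @hom_of S A (fun x : (bspace A * bspace B)%type => x.1) => //.
  move=> U [T [T' [bT bT' UT]]]; apply: born_sub bT.
  by move=> _ [x /UT[Tx _] <-].
have [||p2 p2E] := @hom_of S B (fun x : (bspace A * bspace B)%type => x.2) => //.
  move=> U [T [T' [bT bT' UT]]]; apply: born_sub bT'.
  by move=> _ [x /UT[_ Tx] <-].
exists S, i1, i2, p1, p2; split; apply: homP => x;
  rewrite ?app_add !app_comp ?p1E ?p2E ?i1E ?i2E //.
by case: x => x y; congr pair; rewrite /= ?addr0 ?add0r.
Qed.

(** The zero object is obtained as the kernel of an identity, so some object must be at hand. *)
Lemma pre_abelian_admissible : (exists A : C, True) -> pre_abelian C.
Proof.
move=> [A _]; split.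
- split; last exact: biproduct_exists.
  have [Z [k [kk _ _ _]]] := kernel_exists (idm A).
  by exists Z; exact: zero_object_kernel kk.
- by move=> B D f; have [S [k [kk _ _ _]]] := kernel_exists f; exists S, k.
- by move=> B D f; have [Q [q [qq _]]] := cokernel_exists f; exists Q, q.
Qed.

(** The kernel N of c p1 - d p2 is the concrete pullback, and it maps to A by u. For U bounded in B,
    lift c(U) to a bounded T in E; the pairs of N with entries in U and T form a bounded set M, and
    u(M) lifts U. *)
Lemma cokernel_pullback : stable_under_pullback (@is_cokernel C).
Proof.
move=> A B E D a b c d [cadb ua] /is_cokernelP ld; apply/is_cokernelP => U bU.
have [S [i1 [i2 [p1 [p2 [p1i1 p2i2 p1i2 p2i1 _]]]]]] := biproduct_exists B E.
have [N [k [[fk _] _ rk kE]]] := kernel_exists (c \oc p1 - d \oc p2).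
have [|u [[au bu] _]] := ua N (p1 \oc k) (p2 \oc k).
  by apply/eqP; rewrite -subr_eq0 -fk compDl compNm -!compA.
have [T bT UT] := ld _ (app_bounded c bU).
pose M := [set n | [set app i1 x + app i2 y | x in U & y in T] (app k n)].
have bM : bornology M.
  apply: rk; apply: born_sub (bornD (app_bounded i1 bU) (app_bounded i2 bT)).
  move=> _ [n [x Ux [y Ty <-]] <-].
  by exists (app i1 x); [exists x|exists (app i2 y) => //; exists y].
exists (app u @` M); first exact: app_bounded.
move=> x Ux; have [|y Ty dy] := UT (app c x); first by exists x.
have p1z : app p1 (app i1 x + app i2 y) = x.
  by rewrite appD -!app_comp p1i1 p1i2 app_zero addr0.
have p2z : app p2 (app i1 x + app i2 y) = y.
  by rewrite appD -!app_comp p2i1 p2i2 app_zero add0r.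
have [n _ kn] : range (app k) (app i1 x + app i2 y).
  rewrite kE; change (app (c \oc p1 - d \oc p2) (app i1 x + app i2 y) = 0).
  by rewrite app_add app_opp !app_comp p1z p2z dy subrr.
exists (app u n); last by rewrite -app_comp au app_comp kn.
by exists n => //; rewrite /M/= kn; exists x => //; exists y.
Qed.

(* The antidiagonal subspace that a pushout divides out of the direct sum of B
   and E is closed without taking a closure. *)
Lemma antidiagonal_closed A B E S (a : hom A B) (b : hom A E)
    (p1 : hom S B) (p2 : hom S E) : is_kernel a ->
  born_closed [set w | exists x, app p1 w = app a x /\ app p2 w = - app b x].
Proof.
move=> /is_kernelP[inj_a ra cla] U w bU Uw.
(* The first coordinate of w lies in the range of a because that range is closed. *)
have [x _ ax] : range (app a) (app p1 w).
  apply: cla (app_bounded p1 bU) _ => t; have [u Uu [x [p1x _]]] := Uw t.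
  exists (app p1 u); first by exists u.
  by exists x => //; rewrite -p1x appB appZ.
exists x; split; first by rewrite ax.
pose N := app a @^-1` (app p1 @` U).
have bN : bornology N.
  apply: ra; apply: born_sub (app_bounded p1 bU) => _ [y [u Uu uy] <-].
  by exists u.
(* It remains that p2 w + b x = 0, by separatedness of E: t(p2 w + b x) = p2 u + b(t x - y) with u
   in U and a(t x - y) = p1 u, so the whole line lies in p2(U) + b(N). *)
apply/eqP; rewrite -addr_eq0; apply/eqP.
apply: (line_separatedP (@separated_space E)
  (bornD (app_bounded p2 bU) (app_bounded b bN))) => t.
have [u Uu [y [p1y p2y]]] := Uw t; rewrite appB appZ in p1y.
exists (app p2 u); first by exists u.
exists (app b (t *: x - y)).
  exists (t *: x - y) => //; exists u => //.
  by rewrite appB appZ ax -p1y opprB addrC subrK.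
have : app p2 u = t *: app p2 w + app b y.
  move: p2y; rewrite appB appZ => /eqP; rewrite subr_eq => /eqP ->.
  by rewrite addrAC addNr add0r.
by move=> ->; rewrite appB appZ scalerDr addrACA subrr addr0 addrC.
Qed.

(** The concrete pushout is the quotient q of the biproduct by the antidiagonal W. The given D is a
    retract of it through v u = id, which is enough to check the three conditions of [is_kernelP]
    for d. *)
Lemma kernel_pushout : stable_under_pushout (@is_kernel C).
Proof.
move=> A B E D a b c d [cadb ud] kera.
have [S [i1 [i2 [p1 [p2 [p1i1 p2i2 p1i2 p2i1 ip]]]]]] := biproduct_exists B E.
have cW := antidiagonal_closed (b := b) (p1 := p1) (p2 := p2) kera.
have /is_kernelP[inj_a ra cla] := kera.
set W := [set w | _] in cW.
have sW : linear_subspace W.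
  split; first by exists 0; rewrite !app0 oppr0.
  move=> t v w [x [p1x p2x]] [y [p1y p2y]]; exists (t *: x + y).
  rewrite (app_linear p1) (app_linear p2) (app_linear a) (app_linear b).
  by rewrite p1x p2x p1y p2y opprD scalerN.
have [D' [q [lq qE]]] := closed_quotient sW cW.
have qW w : app q w = 0 -> W w by rewrite -qE.
have Wq w : W w -> app q w = 0 by rewrite -qE.
have p1i2E y : app p1 (app i2 y) = 0 by rewrite -app_comp p1i2.
have p2i2E y : app p2 (app i2 y) = y by rewrite -app_comp p2i2.
have p1i1E y : app p1 (app i1 y) = y by rewrite -app_comp p1i1.
have p2i1E y : app p2 (app i1 y) = 0 by rewrite -app_comp p2i1.
have [|u [[uc ud'] _]] := ud D' (q \oc i1) (q \oc i2).
  apply: homP => x; rewrite !app_comp; apply: subr0_eq; rewrite -appB; apply: Wq.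
  by exists x; rewrite !appB p1i1E p1i2E p2i1E p2i2E subr0 sub0r.
have [|v [vq _]] := @factor_through_lift _ _ D q (c \oc p1 + d \oc p2) lq.
  move=> w /qW[x [p1x p2x]]; rewrite app_add !app_comp p1x p2x -app_comp cadb.
  by rewrite app_comp -appD subrr app0.
have vu : v \oc u = idm D.
  have [w [_ wP]] := ud D c d cadb.
  rewrite -(wP (v \oc u)) ?(wP (idm D)) ?comp1m// -!compA uc ud' !compA vq.
  by rewrite !compDl -!compA p1i1 p2i1 p1i2 p2i2 !compm0 !compm1 addr0 add0r.
(* If d y = 0, then (0, y) is in W, so y = - b x with a x = 0, and x = 0. *)
have inj_d0 y : app d y = 0 -> y = 0.
  move=> dy; have /qW[x []] : app q (app i2 y) = 0.
    by rewrite -app_comp -ud' app_comp dy app0.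
  rewrite p1i2E p2i2E => ax ->; rewrite (_ : x = 0) ?app0 ?oppr0//.
  by apply: inj_a; rewrite -ax app0.
apply/is_kernelP; split.
- by move=> y z dyz; apply: subr0_eq; apply: inj_d0; rewrite appB dyz subrr.
(* Reflection: for y in U, u(d y) lifts to some t in T with (0, y) - t in W. Hence y = p2 t - b x
   with a x = - p1 t, and such x lie in the bounded set N. *)
- move=> U /(app_bounded u)/lq[T bT UT].
  pose N := app a @^-1` [set - x | x in app p1 @` T].
  have bN : bornology N.
    apply: ra; apply: born_sub (bornN (app_bounded p1 bT)).
    by move=> _ [y [x Tx xy] <-]; exists x.
  apply: born_sub (bornD (app_bounded p2 bT) (bornN (app_bounded b bN))).
  move=> y Uy; have [|t Tt qt] := UT (app u (app d y)).
    by exists (app d y) => //; exists y.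
  have /qW[x []] : app q (app i2 y - t) = 0.
    by rewrite appB qt -!app_comp ud' subrr.
  rewrite !appB p1i2E p2i2E sub0r => ax bx.
  exists (app p2 t); first by exists t.
  exists (- app b x); last by rewrite -bx addrC subrK.
  by exists (app b x) => //; exists x => //; exists (app p1 t) => //; exists t.
(* Closed range: lift u(y) to w. Modulo W, t w equals s + (0, e) with s in T, so each t p1(w) is in
   p1(T) plus the range of a; that range is closed, so p1(w) = a x. Then y = c(a x) + d(p2 w) = d(b
   x + p2 w). *)
- move=> U y /(app_bounded u)/lq[T bT UT] Uy.
  have [w qw] := lifts_bounded_surj lq (app u y).
  have [x _ ax] : range (app a) (app p1 w).
    apply: cla (app_bounded p1 bT) _ => t; have [z Uz [e _ de]] := Uy t.
    have [|s Ts qs] := UT (app u z); first by exists z.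
    exists (app p1 s); first by exists s.
    have /qW[x [p1x _]] : app q (t *: w - s - app i2 e) = 0.
      rewrite !appB appZ qw qs -[app q (app i2 e)]app_comp -ud' app_comp de.
      by rewrite appB appZ subrr.
    by exists x => //; rewrite -p1x !appB appZ p1i2E subr0.
  exists (app b x + app p2 w) => //.
  rewrite -[y]app_id -vu app_comp -qw -app_comp vq app_add !app_comp -ax.
  by rewrite appD -!app_comp cadb.
Qed.

Lemma quasi_abelian_admissible : (exists A : C, True) -> quasi_abelian C.
Proof.
move=> C0; split; first exact: pre_abelian_admissible.
  exact: cokernel_pullback.
exact: kernel_pushout.
Qed.

End AdmissibleCategory.

(** * Gauges *)

Section Gauges.
Variables (R : realType) (K : numFieldType) (iota : {rmorphism R -> K}).
Hypothesis iota_mono : {mono iota : x y / x <= y}.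
Hypothesis archiK : forall a : K, exists n, `|a| <= n%:R.
Local Notation disk_seminorm := (disk_seminorm iota).
Local Notation half := (2^-1 : K).

Lemma iota_gt0 x : (0 < iota x) = (0 < x).
Proof. by rewrite -{1}(rmorph0 iota) (leW_mono iota_mono). Qed.

Lemma norm_iota x : 0 <= x -> `|iota x| = iota x.
Proof. by move=> x0; rewrite ger0_norm// -(rmorph0 iota) iota_mono. Qed.

Lemma iota_half n : iota (2^-1 ^+ n) = half ^+ n.
Proof. by rewrite rmorphXn fmorphV rmorph_nat. Qed.

Section Disk.
Variables (X : lmodType K) (B : set X).
Hypothesis acB : absolutely_convex B.
Implicit Types (x y b : X) (a c : K).

(** Divide by a + c; if this is 0, both coefficients vanish. Later estimates can thus track the
    scale of a sum alone. *)
Lemma disk_cone a c x y : 0 <= a -> 0 <= c -> B x -> B y ->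
  exists2 z, B z & a *: x + c *: y = (a + c) *: z.
Proof.
move=> a0 c0 Bx By; have [ac0|ac0] := eqVneq (a + c) 0.
  exists x => //; move: ac0 => /eqP; rewrite paddr_eq0// => /andP[/eqP-> /eqP->].
  by rewrite addr0 !scale0r addr0.
exists ((a + c)^-1 *: (a *: x + c *: y)); last by rewrite scalerA divff ?scale1r.
rewrite scalerDr !scalerA; apply: acB => //.
by rewrite !ger0_norm ?mulr_ge0 ?invr_ge0 ?addr_ge0// -mulrDr mulVf.
Qed.

Lemma disk_shrink a c x : `|a| <= c -> B x -> exists2 z, B z & a *: x = c *: z.
Proof.
move=> ac Bx; have [c0|c0] := eqVneq c 0.
  exists x => //; move: ac; rewrite c0 normr_le0 => /eqP ->.
  by rewrite !scale0r.
exists ((c^-1 * a) *: x); last by rewrite scalerA mulVKf.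
apply: absolutely_convexZ => //; have c_ge0 : 0 <= c by exact: le_trans ac.
rewrite normrM ger0_norm ?invr_ge0// ler_pdivrMl ?mulr1//.
by rewrite lt_def c0.
Qed.

Lemma linear_span_sub b : B b -> linear_span B b.
Proof. by move=> Bb V [_]; exact. Qed.

Lemma linear_subspace_span : linear_subspace (linear_span B).
Proof.
split=> [V [[]]//|a x y Bx By V VP]; have [[_ lV] _] := VP.
by apply: lV; [exact: Bx|exact: By].
Qed.

(** Zero is listed apart because B may be empty; closure under linear combinations comes from
    [disk_shrink] and [disk_cone]. *)
Lemma linear_spanP x : linear_span B x ->
  x = 0 \/ exists c b, [/\ 0 <= c, B b & x = c *: b].
Proof.
suff: linear_span B `<=`
    [set x | x = 0 \/ exists c b, [/\ 0 <= c, B b & x = c *: b]] by exact.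
apply: smallest_sub; last first.
  by move=> b Bb; right; exists 1, b; rewrite scale1r.
split=> [|a y y' [->|[c [b [c0 Bb ->]]]] h]; first by left.
  by rewrite scaler0 add0r.
right; have ac0 : 0 <= `|a * c| by [].
have [b1 Bb1 b1E] : exists2 z, B z & (a * c) *: b = `|a * c| *: z.
  exact: disk_shrink.
case: h => [->|[c' [b' [c'0 Bb' ->]]]].
  by exists `|a * c|, b1; rewrite addr0 scalerA b1E.
have [z Bz zE] := disk_cone ac0 c'0 Bb1 Bb'.
by exists (`|a * c| + c'), z; rewrite scalerA b1E zE addr_ge0.
Qed.

Lemma disk_seminorm_ge0 x : 0 <= disk_seminorm B x.
Proof.
rewrite /Defs.disk_seminorm.
have [->|A0] := eqVneq [set l : R | 0 < l /\ [set iota l *: y | y in B] x] set0.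
  by rewrite inf0.
by apply: lb_le_inf; [exact/set0P|move=> l [/ltW]].
Qed.

Lemma disk_seminorm_le e x : 0 < e -> [set iota e *: y | y in B] x ->
  disk_seminorm B x <= e.
Proof. by move=> e0 Bx; apply: ge_inf => //; exists 0 => l [/ltW]. Qed.

Lemma disk_seminorm_lt e x : B !=set0 -> linear_span B x ->
  disk_seminorm B x < e -> exists l b, [/\ 0 < l, l < e, B b & x = iota l *: b].
Proof.
move=> [b0 Bb0] /linear_spanP xB xe.
have B0 : B 0 by rewrite -(scale0r b0); apply: absolutely_convexZ; rewrite ?normr0.
have hi : has_inf [set l : R | 0 < l /\ [set iota l *: y | y in B] x].
  split; last by exists 0 => l [/ltW].
  case: xB => [->|[c [b [c0 Bb ->]]]].
    by exists 1; split => //; exists 0; rewrite ?scaler0.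
  (* The coefficient c lies in K; a larger integer gives a scale in the image of [iota]. *)
  have [n cn] := archiK c; exists n.+1%:R; split => //.
  have [|z Bz cz] := @disk_shrink c (iota n.+1%:R) b _ Bb; last by exists z.
  by rewrite rmorph_nat; apply: le_trans cn _; rewrite ler_nat.
have e' : 0 < e - disk_seminorm B x by rewrite subr_gt0.
have [l [l0 [b Bb bx]] le] := inf_adherent e' hi.
by exists l, b; rewrite l0 bx; split=> //; rewrite addrC subrK in le.
Qed.

Lemma disk_seminorm_line x : (forall a, B (a *: x)) -> disk_seminorm B x = 0.
Proof.
move=> Bx; apply/eqP; rewrite eq_le disk_seminorm_ge0 andbT.
apply/ler_addgt0Pl => e e0; rewrite addr0; apply: disk_seminorm_le => //.
exists ((iota e)^-1 *: x) => //.
by rewrite scalerA divff ?scale1r// gt_eqF// iota_gt0.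
Qed.

(** If the gauge of x is 0, then x = l b with l < 1/(n+1) for every n. For |a| <= n this puts a x =
    (a l) b into B, so B contains the whole line. *)
Lemma disk_normedP : (forall x, (forall a, B (a *: x)) -> x = 0) ->
  disk_normed iota B.
Proof.
move=> lineB x /[dup] xB /linear_spanP[//|[c [b [c0 Bb xE]]] x0].
apply: lineB => a; have [n an] := archiK a.
have n1 : 0 < n.+1%:R^-1 :> R by rewrite invr_gt0.
have [||l [b' [l0 ln Bb' xE']]] := @disk_seminorm_lt n.+1%:R^-1 x _ xB.
- by exists b.
- by rewrite x0.
rewrite xE' scalerA; apply: absolutely_convexZ => //.
rewrite normrM (norm_iota (ltW l0)).
have : iota l <= n.+1%:R^-1 by rewrite -(rmorph_nat iota) -fmorphV iota_mono ltW.
move=> il; apply: (@le_trans _ _ ((n.+1%:R : K) * n.+1%:R^-1)); last first.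
  by rewrite divff ?pnatr_eq0.
apply: ler_pM => //; first by rewrite ltW// iota_gt0.
by apply: le_trans an _; rewrite ler_nat.
Qed.

Lemma disk_partial_sum (d : nat -> X) : (forall k, B (d k)) -> forall m n,
  exists2 b, B b &
    \sum_(k < m + n) half ^+ k *: d k - \sum_(k < m) half ^+ k *: d k =
    (2 * half ^+ m) *: b.
Proof.
move=> Bd m n.
(* The induction carries the exact weight, the sum of 2^-k over m <= k < m + n. *)
suff [b Bb ->] : exists2 b, B b &
    \sum_(k < m + n) half ^+ k *: d k - \sum_(k < m) half ^+ k *: d k =
    (2 * (half ^+ m - half ^+ (m + n))) *: b.
  apply: disk_shrink => //.
  have le_mn : half ^+ (m + n) <= half ^+ m.
    by rewrite ler_wiXn2l ?invr_ge0 ?leq_addr// invf_le1// ler1n.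
  rewrite ger0_norm ?mulr_ge0 ?subr_ge0// ler_pM2l//.
  by rewrite gerBl exprn_ge0 ?invr_ge0.
elim: n => [|n [b Bb bE]].
  by exists (d 0); rewrite // addn0 !subrr mulr0 scale0r.
have [||z Bz zE] := @disk_cone (2 * (half ^+ m - half ^+ (m + n)))
  (half ^+ (m + n)) b (d (m + n)%N) _ _ Bb (Bd _).
- rewrite mulr_ge0 ?subr_ge0// ler_wiXn2l ?invr_ge0 ?leq_addr//.
  by rewrite invf_le1// ler1n.
- by rewrite exprn_ge0 ?invr_ge0.
exists z => //; rewrite addnS big_ord_recr /= addrAC bE zE; congr (_ *: _).
by rewrite exprSr; field.
Qed.

(** The partial sums are Cauchy for the gauge. Their limit is compared with the N-th sum through a
    far index: [2 * 2^-N] from the tail and r < 2^-N from the limit stay below [4 * 2^-N]. *)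
Lemma disk_banach_series_complete : B !=set0 ->
  disk_banach iota B -> series_complete B.
Proof.
move=> B0 [_ banB] d Bd; pose u n := \sum_(k < n) half ^+ k *: d k.
have half_gt0 n : 0 < (2^-1 : R) ^+ n by rewrite exprn_gt0 ?invr_gt0.
have uB n : linear_span B (u n).
  apply: (linear_subspace_sum linear_subspace_span) => k.
  by apply: (linear_subspaceZ linear_subspace_span); exact: linear_span_sub.
have BN b : B b -> B (- b).
  by move=> Bb; rewrite -scaleN1r; apply: absolutely_convexZ; rewrite ?normrN1.
have uD N m n : (N <= m)%N -> (N <= n)%N -> exists2 b, B b &
    u m - u n = iota (4 * 2^-1 ^+ N) *: b.
  move=> /subnKC <- /subnKC <-.
  have [b Bb bE] := disk_partial_sum Bd N (m - N).
  have [c Bc cE] := disk_partial_sum Bd N (n - N).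
  have h0 : 0 <= 2 * half ^+ N by rewrite mulr_ge0 ?exprn_ge0 ?invr_ge0.
  have [z Bz zE] := disk_cone h0 h0 Bb (BN _ Bc).
  exists z => //; rewrite rmorphM rmorph_nat iota_half.
  rewrite (_ : 4 * _ = 2 * half ^+ N + 2 * half ^+ N) -?zE; last by ring.
  rewrite scalerN -bE -cE opprB addrA subrK.
  by [].
have [|l lB ul] := banB u uB.
- move=> e e0; have [n en] : exists n, e^-1 < n%:R.
    by exists (Num.bound e^-1); apply: archi_boundP; rewrite invr_ge0 ltW.
  (* The shift by 2 absorbs the factor 4. *)
  exists (n + 2)%N => m p mN pN; have [b Bb ->] := uD _ _ _ mN pN.
  apply: (@le_lt_trans _ _ (4 * 2^-1 ^+ (n + 2))).
    by apply: disk_seminorm_le; [rewrite mulr_gt0|exists b].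
  rewrite exprD mulrCA (_ : 4 * _ = 1) ?mulr1; last by field.
  rewrite exprVn invf_plt ?posrE ?exprn_gt0//; apply: lt_trans en _.
  by rewrite -natrX ltr_nat ltn_expl.
exists l => N; move/cvgr0Pnorm_lt : ul => /(_ _ (half_gt0 N)) [M _ /(_ (N + M)%N)].
rewrite /= leq_addl ger0_norm ?disk_seminorm_ge0// => /(_ isT).
have ulB : linear_span B (u (N + M)%N - l).
  exact: (linear_subspaceB linear_subspace_span).
move=> /(disk_seminorm_lt B0 ulB)[r [b [r0 rN Bb bE]]].
have [c Bc cE] := disk_partial_sum Bd N M.
have h0 : 0 <= 2 * half ^+ N by rewrite mulr_ge0 ?exprn_ge0 ?invr_ge0.
have r0' : 0 <= iota r by rewrite ltW// iota_gt0.
have [z Bz zE] := disk_cone h0 r0' Bc (BN _ Bb).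
rewrite (_ : _ - _ = (2 * half ^+ N + iota r) *: z); last first.
  rewrite /u in bE.
  by rewrite -zE -cE scalerN -bE opprB [RHS]addrC addrA subrK.
apply: disk_shrink => //; rewrite ger0_norm ?addr_ge0//.
rewrite (_ : 4 * _ = 2 * half ^+ N + 2 * half ^+ N); last by ring.
rewrite lerD2l; apply: (@le_trans _ _ (half ^+ N)).
  by rewrite -iota_half iota_mono ltW.
by rewrite ler_peMl ?exprn_ge0 ?invr_ge0// ler1n.
Qed.

(** Along a subsequence the increments of a Cauchy sequence are 2^-k d_k with d_k in B, and series
    completeness sums them. *)
Lemma series_complete_disk_banach : B 0 -> disk_normed iota B ->
  series_complete B -> disk_banach iota B.
Proof.
move=> B0 nB sB; split=> // u uB cu.
have half_gt0 n : 0 < (2^-1 : R) ^+ n by rewrite exprn_gt0 ?invr_gt0.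
have nzB : B !=set0 by exists 0.
have BN b : B b -> B (- b).
  by move=> Bb; rewrite -scaleN1r; apply: absolutely_convexZ; rewrite ?normrN1.
have [N NP] := choice (fun k => cu _ (half_gt0 k)).
(* The maximum makes the chosen indices monotone in k. *)
pose M k := (\max_(j < k.+1) N j)%N.
have NM j k : (j <= k)%N -> (N j <= M k)%N.
  by rewrite -ltnS => jk; exact: (leq_bigmax (Ordinal jk)).
have near k m n : (M k <= m)%N -> (M k <= n)%N -> exists2 b, B b &
    u m - u n = half ^+ k *: b.
  move=> km kn; have kk := NM k k (leqnn k).
  have uuB : linear_span B (u m - u n).
    exact: (linear_subspaceB linear_subspace_span).
  have := NP k _ _ (leq_trans kk km) (leq_trans kk kn).
  move=> /(disk_seminorm_lt nzB uuB)[r [b [r0 rk Bb ->]]].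
  apply: disk_shrink => //.
  by rewrite (norm_iota (ltW r0)) -iota_half iota_mono ltW.
have MS k : (M k <= M k.+1)%N.
  by apply/bigmax_leqP => j _; apply: NM; rewrite ltnW.
have [d Bd dE] := all_sig2 (fun k => cid2 (near k _ _ (MS k) (leqnn _))).
have [s sP] := sB _ Bd.
have sumE n : \sum_(k < n) half ^+ k *: d k = u (M n) - u (M 0).
  rewrite -(telescope_sumr (fun k => u (M k)))// big_mkord.
  by apply: eq_bigr => k _; rewrite dE.
(* The Cauchy condition contributes 2^-k and the remainder of the series [4 * 2^-k]. *)
have lP k n : (M k <= n)%N -> exists2 b, B b &
    u n - (s + u (M 0)) = iota (5 * 2^-1 ^+ k) *: b.
  move=> kn; have [b Bb bE] := near _ _ _ kn (leqnn _).
  have [c Bc] := sP k; rewrite sumE => cE.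
  have h0 : 0 <= half ^+ k by rewrite exprn_ge0 ?invr_ge0.
  have h4 : 0 <= 4 * half ^+ k by rewrite mulr_ge0.
  have [z Bz zE] := disk_cone h0 h4 Bb (BN _ Bc).
  exists z => //; rewrite rmorphM rmorph_nat iota_half.
  rewrite (_ : 5 * _ = half ^+ k + 4 * half ^+ k) -?zE; last by ring.
  by rewrite scalerN -bE -cE opprB !addrA subrK opprD addrA addrAC.
exists (s + u (M 0)).
  have [b Bb bE] := lP 0 _ (leqnn _).
  rewrite -[X in linear_span B X](subKr (u (M 0))) bE.
  apply: (linear_subspaceB linear_subspace_span) => //.
  by apply: (linear_subspaceZ linear_subspace_span); exact: linear_span_sub.
apply/cvgr0Pnorm_lt => e e0; have [n en] : exists n, e^-1 < n%:R.
  by exists (Num.bound e^-1); apply: archi_boundP; rewrite invr_ge0 ltW.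
(* The shift by 3 absorbs the factor 5, since 5 <= 2^3. *)
exists (M (n + 3)%N) => // m /= nm; have [b Bb ->] := lP _ _ nm.
rewrite ger0_norm ?disk_seminorm_ge0//.
apply: (@le_lt_trans _ _ (5 * 2^-1 ^+ (n + 3))).
  by apply: disk_seminorm_le; [rewrite mulr_gt0|exists b].
apply: (@le_lt_trans _ _ (2^-1 ^+ n)).
  rewrite exprD mulrCA ler_piMr ?exprn_ge0 ?invr_ge0//.
  by rewrite exprVn ler_pdivrMr ?exprn_gt0// mul1r -natrX ler_nat.
rewrite exprVn invf_plt ?posrE ?exprn_gt0//; apply: lt_trans en _.
by rewrite -natrX ltr_nat ltn_expl.
Qed.

End Disk.

(** The hull of a bounded line is a bounded disk whose gauge vanishes on the line; the converse is
    [disk_normedP]. *)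
Lemma separatedP (X : bornSpace K) : separated iota X <-> line_separated X.
Proof.
split=> [sX x bx|sX B bB acB].
  pose B := absolutely_convex_hull (range (fun a : K => a *: x)).
  have Bx a : B (a *: x) by apply: sub_absolutely_convex_hull; exists a.
  apply: (sX B (born_hull bx)); first exact: absolutely_convex_hullP.
    by rewrite -[x]scale1r; exact: linear_span_sub.
  by apply: disk_seminorm_line => //; exact: absolutely_convex_hullP.
by apply: disk_normedP => // x Bx; exact: line_separatedP sX bB Bx.
Qed.

Lemma bornologically_completeP (X : bornSpace K) :
  bornologically_complete iota X <->
  line_separated X /\ series_complete_space X.
Proof.
split=> [cX|[sX cX] A /cX[B [bB acB AB B0 sB]]]; last first.
  exists B; split=> //; apply: series_complete_disk_banach => //.
  by apply: disk_normedP => // x Bx; exact: line_separatedP sX bB Bx.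
split=> [x /cX[B [bB acB xB [nB _]]]|A bA].
  have Bx a : B (a *: x) by apply: xB; exists a.
  apply: nB; last exact: disk_seminorm_line.
  by rewrite -[x]scale1r; exact: linear_span_sub.
(* Adding 0 to A forces the disk to contain 0. *)
have [B [bB acB AB banB]] := cX _ (bornU bA (born1 0)).
have B0 : B 0 by apply: AB; right.
exists B; split=> //; first by move=> x Ax; apply: AB; left.
by apply: disk_banach_series_complete => //; exists 0.
Qed.

End Gauges.

(** * The counterexample *)

Section SolidSequenceSpaces.
Variable K : numFieldType.
Hypothesis archiK : forall a : K, exists n, `|a| <= n%:R.
Hypothesis seriesK : forall (w : K) (d : nat -> K), (forall k, `|d k| <= w) ->
  exists s, forall N,
    `|s - \sum_(k < N) 2^-1 ^+ k * d k| <= 4 * 2^-1 ^+ N * w.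
Local Notation sequences := (nat -> K^o).
Implicit Types (w : sequences) (n : nat).

(** These are order ideals as in Riesz spaces, with moduli of scalars in place of lattice
    operations. *)
Definition solid (V : set sequences) := linear_subspace V /\
  forall x y, V y -> (forall n, `|x n| <= `|y n|) -> V x.

Section SolidSpace.
Variables (V : set sequences) (S : lmodType K) (i : S -> sequences).
Hypotheses (solV : solid V) (li : linear i) (inj_i : injective i).
Hypothesis iV : range i = V.

Let order_interval w : set S := [set x | forall n, `|i x n| <= `|w n|].

Let V_range x : V x -> exists s, i s = x.
Proof. by rewrite -iV => -[s _ <-]; exists s. Qed.

Let absconv_interval w : absolutely_convex (order_interval w).
Proof.
move=> a b x y ab xw yw n; rewrite (linearfD li) !(linearfZ li) /=.
apply: le_trans (ler_normD _ _) _; rewrite !normrM.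
apply: (@le_trans _ _ ((`|a| + `|b|) * `|w n|)); last exact: ler_piMl.
by rewrite mulrDl lerD// ler_wpM2l.
Qed.

(** One construction serves all three spaces. For all sequences it gives the product bornology, for
    finitely supported ones the fine bornology, and for those supported at index 0 the usual
    bornology of a line. *)
Definition solid_born : bornSpace K.
Proof.
refine (@BornSpace K S [set A | exists2 w, V w & A `<=` order_interval w]
  _ _ _ _ _) => /=.
- move=> x; exists (i x); first by rewrite -iV; exists x.
  by move=> _ -> n.
- by move=> A B AB [w Vw Bw]; exists w => //; exact: subset_trans Bw.
- move=> A B [w Vw Aw] [w' Vw' Bw'].
  have Vabs y : V y -> V (fun n => `|y n|).
    by move=> Vy; apply: solV.2 Vy _ => n; rewrite normr_id.
  (* Absolute values prevent cancellation, so the sum dominates both w and w'. *)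
  exists ((fun n => `|w n|) + (fun n => `|w' n|)).
    by apply: (linear_subspaceD solV.1); exact: Vabs.
  move=> x [/Aw xw|/Bw' xw] n; apply: (le_trans (xw n)).
    by rewrite [leRHS]ger0_norm ?addr_ge0// lerDl.
  by rewrite [leRHS]ger0_norm ?addr_ge0// lerDr.
- move=> l A l0 [w Vw Aw]; exists (l *: w).
    exact: (linear_subspaceZ solV.1).
  move=> _ [x /Aw xw <-] n; rewrite (linearfZ li) /= !normrM.
  exact: ler_wpM2l.
- move=> A [w Vw Aw]; exists w => //.
  exact: absolutely_convex_hull_min.
Defined.

Lemma line_separated_solid : line_separated solid_born.
Proof.
move=> x [w Vw xw]; apply: inj_i; rewrite (linearf0 li); apply/funext => n /=.
apply/eqP; rewrite -normr_eq0; apply/negP => /negP xn.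
(* This multiple has n-th coordinate of modulus |w n| + 1, outside the interval. *)
have : `|i (((`|w n| + 1) / `|i x n|) *: x) n| <= `|w n|.
  by apply: xw; exists ((`|w n| + 1) / `|i x n|).
rewrite (linearfZ li) /= !normrM normfV normr_id divfK//.
by rewrite ger0_norm ?addr_ge0// gerDl ler10.
Qed.

Lemma series_complete_solid : series_complete_space solid_born.
Proof.
move=> A [w Vw Aw]; exists (order_interval w); split => //.
- by exists w.
- by move=> n; rewrite (linearf0 li) /= normr0.
move=> d dw.
have /choice[s sP] : forall n, exists t, forall N,
    `|t - \sum_(k < N) 2^-1 ^+ k * i (d k) n| <= 4 * 2^-1 ^+ N * `|w n|.
  by move=> n; apply: (@seriesK `|w n| (fun k => i (d k) n)) => k; exact: dw.
(* The estimate for N = 0 reads |s| <= 4|w|, so solidity puts the coordinatewise sum into V. *)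
have [t ts] : exists t, i t = s.
  apply: V_range; apply: (solV.2 s (4 *: w)).
    exact: (linear_subspaceZ solV.1).
  move=> n; have := sP n 0; rewrite big_ord0 subr0 expr0 mulr1.
  by rewrite /= normrM ger0_norm.
exists t => N; have c0 : 0 < 4 * 2^-1 ^+ N :> K.
  by rewrite mulr_gt0 ?exprn_gt0 ?invr_gt0.
set r := t - _; exists ((4 * 2^-1 ^+ N)^-1 *: r); last first.
  by rewrite scalerA divff ?scale1r// gt_eqF.
move=> n; rewrite (linearfZ li) /= normrM gtr0_norm ?invr_gt0// ler_pdivrMl//.
have ln : linear (fun x : S => i x n) by move=> a x y; rewrite li.
rewrite (_ : i r n = s n - \sum_(k < N) 2^-1 ^+ k * i (d k) n); first exact: sP.
apply: etrans (linearfB ln _ _) _; rewrite (linearf_sum ln) -ts.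
by congr (_ - _); apply: eq_bigr => k _; exact: (linearfZ ln).
Qed.

End SolidSpace.

Lemma solid_space (V : set sequences) : solid V ->
  exists (X : bornSpace K) (i : X -> sequences),
  [/\ linear i, injective i, range i = V,
      line_separated X /\ series_complete_space X &
      forall A : set X, bornology A <->
        exists2 w, V w & forall x : X, A x -> forall n, `|i x n| <= `|w n|].
Proof.
move=> solV; have [S [i [li inj_i iV]]] := subspace_model solV.1.
exists (solid_born solV li iV), i; split => //.
by split; [exact: line_separated_solid|exact: series_complete_solid].
Qed.

Lemma solid_all : solid [set: sequences].
Proof. by []. Qed.

Lemma solid_finite : solid [set x | exists N, forall n, (N <= n)%N -> x n = 0].
Proof.
split=> [|x y [N yN] xy].
  split=> [|a x y [N xN] [M yM]]; first by exists 0.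
  exists (maxn N M) => n; rewrite geq_max => /andP[Nn Mn].
  by change (a * x n + y n = 0); rewrite xN// yM// mulr0 addr0.
exists N => n Nn; apply/eqP; rewrite -normr_eq0 eq_le normr_ge0 andbT.
by apply: le_trans (xy n) _; rewrite yN// normr0.
Qed.

(** This models the scalar line; its coordinate at 0 becomes the value of a constant sequence. *)
Lemma solid_first : solid [set x | forall n, (0 < n)%N -> x n = 0].
Proof.
split=> [|x y y0 xy n n0].
  split=> [//|a x y x0 y0 n n0]; change (a * x n + y n = 0).
  by rewrite x0// y0// mulr0 addr0.
apply/eqP; rewrite -normr_eq0 eq_le normr_ge0 andbT.
by apply: le_trans (xy n) _; rewrite y0// normr0.
Qed.

Section Main.
Variable P : bornSpace K -> Prop.
Hypothesis admP : admissible P.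
Hypothesis PC : forall X, line_separated X -> series_complete_space X -> P X.
Local Notation C := (full_subcategory (C := Born K) P).

(* Truncations converge to a sequence x within the disk |y(n)| <= n |x(n)|, so E
   is dense in D. *)
Lemma epi_disjoint_exists : exists (L E D : C) (c : hom L D) (d : hom E D),
  [/\ epimorphism d,
      forall Z (x : hom Z L) (y : hom Z E), c \oc x = d \oc y -> x = 0 /\ y = 0
    & idm L <> 0].
Proof.
have [D0 [iD [lD inj_D rD [sD cD] bD]]] := solid_space solid_all.
have [E0 [iE [lE inj_E rE [sE cE] bE]]] := solid_space solid_finite.
have [L0 [iL [lL inj_L rL [sL cL] bL]]] := solid_space solid_first.
pose D : C := exist _ D0 (PC sD cD).
pose E : C := exist _ E0 (PC sE cE).
pose L : C := exist _ L0 (PC sL cL).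
(* Since [iD] is onto all sequences, maps into D can be given as maps into sequences followed by its
   inverse j. *)
have /choice[j jP] : forall f : sequences, exists x, iD x = f.
  move=> f; have [x _ <-] : range iD f by rewrite rD.
  by exists x.
have jK x : j (iD x) = x by apply: inj_D.
have j_linear (f : sequences -> sequences) : linear f -> linear (j \o f).
  by move=> lf a x y; apply: inj_D; rewrite lD /= !jP lf.
have [||d dE] := @hom_of K P E D (fun x => j (iE x)).
- by move=> a x y; rewrite lE; exact: (j_linear id).
- move=> U /bE[w _ Uw]; apply/bD; exists w => // _ [x Ux <-] n.
  by rewrite jP; exact: Uw.
have [||c cE'] := @hom_of K P L D (fun x => j (fun=> iL x 0)).
- move=> a x y; rewrite lL.
  exact: (j_linear (fun f : sequences => fun=> f 0)).
- move=> U /bL[w _ Uw]; apply/bD; exists (fun=> w 0) => // _ [x Ux <-] n.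
  by rewrite jP; exact: Uw.
exists L, E, D, c, d; split.
- move=> Z g h ghd; apply: homP => x; apply: subr0_eq.
  pose f : hom D Z := g - h; have fd y : app f (app d y) = 0.
    by rewrite -app_comp compDl compNm ghd subrr.
  have b1 : bornology
      [set y : bspace D | forall n, `|iD y n| <= `|n%:R * iD x n|].
    by apply/bD; exists (fun n => n%:R * iD x n).
  (* For |a| <= N let t be a x cut off at index N. As f kills d t, a f(x) is the image of a x - d t,
     whose coordinates vanish for n < N and have modulus at most n |x n| from N on. *)
  apply: (line_separatedP (separated_space admP (A := Z))
    (app_bounded f b1)) => a; have [N aN] := archiK a.
  have [t tE] : exists t, iE t = fun n => if (n < N)%N then a *: iD x n else 0.
    suff [t _ tE] : range iE (fun n => if (n < N)%N then a *: iD x n else 0).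
      by exists t.
    by rewrite rE; exists N => n; rewrite leqNgt => /negbTE ->.
  exists (a *: x - app d t); last by rewrite appB fd subr0 appZ.
  move=> n; rewrite (linearfB lD) (linearfZ lD) dE jP tE /=.
  change (`|a * iD x n - (if (n < N)%N then a * iD x n else 0)|
    <= `|n%:R * iD x n|); case: ltnP => [_|Nn].
    by rewrite subrr normr0.
  rewrite subr0 !normrM ler_wpM2r// normr_nat; apply: le_trans aN _.
  by rewrite ler_nat.
- move=> Z x y cxdy.
  have cd z : (fun=> iL (app x z) 0) = iE (app y z).
    have := congr1 iD (app_eq z cxdy).
    by rewrite !app_comp cE' dE !jP.
  (* A constant sequence with finite support is zero. *)
  have x0 z : iL (app x z) 0 = 0.
    have [N /(_ N (leqnn N)) <-] : [set x : sequences | exists N, forall n,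
        (N <= n)%N -> x n = 0] (iE (app y z)) by rewrite -rE; exists (app y z).
    by rewrite -cd.
  split; apply: homP => z.
    apply: inj_L; rewrite app_zero (linearf0 lL); apply/funext => -[|n].
      exact: x0.
    have : [set x : sequences | forall n, (0 < n)%N -> x n = 0] (iL (app x z)).
      by rewrite -rL; exists (app x z).
    exact.
  by apply: inj_E; rewrite app_zero (linearf0 lE) -cd x0.
- move=> idL0; have [x _ xE] : range iL (fun n => (n == 0)%:R).
    by rewrite rL => -[].
  have : iL x 0 = 0.
    have -> : x = 0 by exact: (app_eq (A := L) (B := L) x idL0).
    by rewrite (linearf0 lL).
  by rewrite xE => /eqP; rewrite oner_eq0.
Qed.

Lemma quasi_abelian_not_integral :
  [/\ quasi_abelian C, ~ left_integral C & ~ right_integral C].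
Proof.
have [L [E [D [c [d [epi_d disj L0]]]]]] := epi_disjoint_exists.
split; first by apply: quasi_abelian_admissible => //; exists L.
  exact: epi_disjoint_not_left_integral epi_d disj L0.
exact: epi_disjoint_not_right_integral epi_d disj L0.
Qed.

End Main.
End SolidSequenceSpaces.

(** * Series with weights 2^-k over the real and the complex numbers *)

(** The intervals of radius [r N] around the partial sums are nested; the supremum of their left
    ends lies in all of them. *)
Lemma real_series (R : realType) (w : R) (d : nat -> R) :
  (forall k, `|d k| <= w) -> exists s, forall N,
  `|s - \sum_(k < N) 2^-1 ^+ k * d k| <= 2 * 2^-1 ^+ N * w.
Proof.
move=> dw; pose S N := \sum_(k < N) 2^-1 ^+ k * d k.
pose r N : R := 2 * 2^-1 ^+ N * w.
have w0 : 0 <= w by apply: le_trans (dw 0).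
have r_ge0 N : 0 <= r N by rewrite !mulr_ge0 ?exprn_ge0 ?invr_ge0.
have step N : `|S N.+1 - S N| <= r N - r N.+1.
  rewrite /S big_ord_recr /= addrAC subrr add0r normrM.
  rewrite ger0_norm ?exprn_ge0 ?invr_ge0//.
  have -> : r N - r N.+1 = 2^-1 ^+ N * w by rewrite /r exprS; field.
  by rewrite ler_wpM2l ?exprn_ge0 ?invr_ge0.
have lo : nondecreasing_seq (fun N => S N - r N).
  apply/nondecreasing_seqP => N; have := step N; rewrite ler_norml => /andP[h _].
  by lra.
have hi : nonincreasing_seq (fun N => S N + r N).
  apply/nonincreasing_seqP => N; have := step N; rewrite ler_norml => /andP[_ h].
  by lra.
have lohi M N : S M - r M <= S N + r N.
  apply: le_trans (lo _ _ (leq_maxl M N)) _.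
  apply: le_trans _ (hi _ _ (leq_maxr M N)).
  by have := r_ge0 (maxn M N); lra.
have hs : has_sup (range (fun N => S N - r N)).
  split; first by exists (S 0 - r 0); exists 0%N.
  by exists (S 0 + r 0) => _ [M _ <-]; exact: lohi.
exists (sup (range (fun N => S N - r N))) => N.
have h1 : S N - r N <= sup (range (fun N => S N - r N)).
  by apply: sup_upper_bound => //; exists N.
have h2 : sup (range (fun N => S N - r N)) <= S N + r N.
  by apply: ge_sup => [|_ [M _ <-]]; [exact: hs.1|exact: lohi].
by rewrite ler_norml -/(S N) -/(r N); apply/andP; split; lra.
Qed.

Section ComplexScalars.
Variable R : realType.
Local Open Scope complex_scope.
Implicit Types (z w : R[i]) (a b : R).

Lemma complex_normE a b : `|a +i* b| = (Num.sqrt (a ^+ 2 + b ^+ 2))%:C.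
Proof. by []. Qed.

Lemma norm_Re_le z : `|complex.Re z|%:C <= `|z|.
Proof.
by case: z => a b; rewrite complex_normE lecR -sqrtr_sqr ler_wsqrtr//
  lerDl sqr_ge0.
Qed.

Lemma norm_Im_le z : `|complex.Im z|%:C <= `|z|.
Proof.
by case: z => a b; rewrite complex_normE lecR -sqrtr_sqr ler_wsqrtr//
  lerDr sqr_ge0.
Qed.

Lemma complex_norm_leD a b : `|a +i* b| <= (`|a| + `|b|)%:C.
Proof.
rewrite complex_normE lecR -[leRHS]ger0_norm ?addr_ge0// -sqrtr_sqr.
rewrite ler_wsqrtr// sqrrD !real_normK ?num_real// addrAC lerDl.
by rewrite mulrn_wge0 ?mulr_ge0.
Qed.

Lemma complex_archimedean z : exists n, `|z| <= n%:R.
Proof.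
case: z => a b; rewrite complex_normE.
exists (Num.bound (Num.sqrt (a ^+ 2 + b ^+ 2))).
rewrite -(rmorph_nat (real_complex R)) lecR ltW//.
by apply: archi_boundP; exact: sqrtr_ge0.
Qed.

(** Real and imaginary parts are summed separately with constant 2 each; |a + ib| <= |a| + |b| turns
    this into 4. *)
Lemma complex_series w (d : nat -> R[i]) : (forall k, `|d k| <= w) ->
  exists s, forall N,
  `|s - \sum_(k < N) 2^-1 ^+ k * d k| <= 4 * 2^-1 ^+ N * w.
Proof.
move=> dw; have w0 : 0 <= w by apply: le_trans (dw 0).
(* As w bounds a modulus, it is a nonnegative real. *)
have [r wr] : exists r, w = r%:C.
  by exists (complex.Re w); rewrite RRe_real// ger0_real.
have dRe k : `|complex.Re (d k)| <= r.
  by rewrite -lecR -wr; apply: le_trans (norm_Re_le _) (dw k).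
have dIm k : `|complex.Im (d k)| <= r.
  by rewrite -lecR -wr; apply: le_trans (norm_Im_le _) (dw k).
have [s1 s1P] := real_series dRe; have [s2 s2P] := real_series dIm.
have halfE k : 2^-1 ^+ k = (2^-1 ^+ k)%:C :> R[i].
  by rewrite rmorphXn fmorphV rmorph_nat.
exists (s1 +i* s2) => N.
have -> : \sum_(k < N) 2^-1 ^+ k * d k =
    (\sum_(k < N) 2^-1 ^+ k * complex.Re (d k)) +i*
    (\sum_(k < N) 2^-1 ^+ k * complex.Im (d k)).
  elim: N => [|N IH]; first by rewrite !big_ord0.
  rewrite !big_ord_recr /= IH halfE; case: (d N) => a b /=.
  by apply/eqP; rewrite eq_complex /= !mul0r subr0 addr0 !eqxx.
apply: le_trans (complex_norm_leD _ _) _.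
have -> : 4 * 2^-1 ^+ N * w = (4 * 2^-1 ^+ N * r)%:C.
  by rewrite wr !rmorphM halfE rmorph_nat.
by rewrite lecR; have := lerD (s1P N) (s2P N); lra.
Qed.

End ComplexScalars.

(** * The separated and the complete spaces over a common scalar field *)

Section BornologicalCategories.
Variables (R : realType) (K : numFieldType) (iota : {rmorphism R -> K}).
Hypothesis iota_mono : {mono iota : x y / x <= y}.
Hypothesis archiK : forall a : K, exists n, `|a| <= n%:R.
Hypothesis seriesK : forall (w : K) (d : nat -> K), (forall k, `|d k| <= w) ->
  exists s, forall N,
    `|s - \sum_(k < N) 2^-1 ^+ k * d k| <= 4 * 2^-1 ^+ N * w.

Lemma separated_not_integral : [/\ quasi_abelian (SepBorn iota),
  ~ left_integral (SepBorn iota) & ~ right_integral (SepBorn iota)].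
Proof.
rewrite /SepBorn (_ : separated iota = @line_separated K); last first.
  by apply/funext => X; apply/propext; exact: separatedP.
apply: quasi_abelian_not_integral => //; exact: admissible_line_separated.
Qed.

Lemma complete_not_integral : [/\ quasi_abelian (CplBorn iota),
  ~ left_integral (CplBorn iota) & ~ right_integral (CplBorn iota)].
Proof.
rewrite /CplBorn (_ : bornologically_complete iota =
    fun X => line_separated X /\ series_complete_space X); last first.
  by apply/funext => X; apply/propext; exact: bornologically_completeP.
apply: quasi_abelian_not_integral => //; exact: admissible_series_complete.
Qed.

End BornologicalCategories.

Theorem theorem4p2 (R : realType) (k : scalars) :
  (quasi_abelian (SepBorn (@scalar_incl R k)) /\
   ~ left_integral (SepBorn (@scalar_incl R k)) /\
   ~ right_integral (SepBorn (@scalar_incl R k))) /\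
  (quasi_abelian (CplBorn (@scalar_incl R k)) /\
   ~ left_integral (CplBorn (@scalar_incl R k)) /\
   ~ right_integral (CplBorn (@scalar_incl R k))).
Proof.
case: k.
- have mono : {mono (idfun : {rmorphism R -> R}) : x y / x <= y} by [].
  have archi (a : R) : exists n, `|a| <= n%:R.
    by exists (Num.bound `|a|); apply/ltW/archi_boundP.
  have series (w : R) (d : nat -> R) : (forall k, `|d k| <= w) ->
      exists s, forall N,
      `|s - \sum_(k < N) 2^-1 ^+ k * d k| <= 4 * 2^-1 ^+ N * w.
    (* The constant 2 of the real case is weakened to the 4 shared with the complex case. *)
    move=> dw; have [s sP] := real_series dw; exists s => N.
    apply: le_trans (sP N) _; have w0 : 0 <= w by apply: le_trans (dw 0).
    by rewrite -!mulrA ler_wpM2r ?ler_nat// mulr_ge0 ?exprn_ge0 ?invr_ge0.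
  have [? ? ?] := separated_not_integral mono archi series.
  by have [? ? ?] := complete_not_integral mono archi series.
- have mono : {mono (real_complex R : {rmorphism R -> R[i]%C}) : x y / x <= y}.
    by move=> x y; rewrite lecR.
  have [? ? ?] := separated_not_integral mono
    (@complex_archimedean R) (@complex_series R).
  by have [? ? ?] := complete_not_integral mono
    (@complex_archimedean R) (@complex_series R).
Qed.
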